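(* Let $(X,d_X)$ and $(Y,d_Y)$ be uniformly locally finite metric spaces. If the uniform Roe algebras $\mathrm{C}^*_u(X)$ and $\mathrm{C}^*_u(Y)$ are $^*$-isomorphic, then $X$ and $Y$ are bijectively coarsely equivalent.
   Context: A metric space $(X,d)$ is uniformly locally finite (u.l.f.) if $\sup_{x\in X}|B_r(x)|<\infty$ for every $r>0$, where $B_r(x)$ is the ball of radius $r$ about $x$. For an $X$-by-$X$ complex matrix $a=[a_{x,x'}]$, its propagation is $\sup\{d(x,x')\mid a_{x,x'}\neq 0\}$; finite propagation matrices with uniformly bounded entries define bounded operators on $\ell_2(X)$. The uniform Roe algebra $\mathrm{C}^*_u(X)$ is the norm closure in $\mathcal B(\ell_2(X))$ of the $^*$-algebra of finite propagation operators. A map $f\colon X\to Y$ is coarse if for every $r>0$ there is $s>0$ with $d_X(x,x')\le r\Rightarrow d_Y(f(x),f(x'))\le s$; maps $f,g\colon X\to Y$ are close if $\sup_x d_Y(f(x),g(x))<\infty$; $f$ is a coarse equivalence if there is a coarse $g\colon Y\to X$ with $f\circ g$ close to $\mathrm{Id}_Y$ and $g\circ f$ close to $\mathrm{Id}_X$. $X$ and $Y$ are bijectively coarsely equivalent if there is a bijective coarse equivalence $X\to Y$. *)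

(* Defs.v *)
From mathcomp Require Import all_boot all_order all_algebra.
From mathcomp Require Import reals complex.
Set Implicit Arguments. Unset Strict Implicit. Unset Printing Implicit Defensive.
Import Order.TTheory GRing.Theory Num.Theory.
Local Open Scope ring_scope.
Local Open Scope complex_scope.

Section Defs.
Variable R : realType.
Local Notation C := R[i].

Definition is_metric (X : Type) (d : X -> X -> R) : Prop :=
  (forall x, d x x = 0) /\ (forall x y, d x y = 0 -> x = y) /\
  (forall x y, d x y = d y x) /\ (forall x y z, d x z <= d x y + d y z).

(* u.l.f.: for every r > 0, the balls B_r(x) = {x' | d x x' <= r} have
   uniformly bounded (finite) cardinality: any duplicate-free list of points
   of B_r(x) has length <= N, with N independent of x. *)
Definition ulf (X : eqType) (d : X -> X -> R) : Prop :=
  forall r : R, 0 < r -> exists N : nat, forall (x : X) (s : seq X),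
    uniq s -> (forall y, y \in s -> d x y <= r) -> (size s <= N)%N.

Definition coarse (X Y : Type) (dX : X -> X -> R) (dY : Y -> Y -> R)
  (f : X -> Y) : Prop :=
  forall r : R, 0 < r -> exists s : R, 0 < s /\
    forall x x', dX x x' <= r -> dY (f x) (f x') <= s.

Definition close (X Y : Type) (dY : Y -> Y -> R) (f g : X -> Y) : Prop :=
  exists M : R, forall x, dY (f x) (g x) <= M.

Definition coarse_equivalence (X Y : Type) (dX : X -> X -> R)
  (dY : Y -> Y -> R) (f : X -> Y) : Prop :=
  coarse dX dY f /\ exists g : Y -> X, coarse dY dX g /\
    close dY (f \o g) id /\ close dX (g \o f) id.

Definition bij_coarse_equiv (X Y : Type) (dX : X -> X -> R)
  (dY : Y -> Y -> R) : Prop :=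
  exists f : X -> Y, bijective f /\ coarse_equivalence dX dY f.

(* ---------- X-by-X complex matrices as operators on l2(X) ---------- *)
Definition mat (X : Type) := X -> X -> C.

(* finite sums over a finite duplicate-free support s *)
Definition sqnorm (X : Type) (s : seq X) (xi : X -> C) : C :=
  \sum_(x <- s) `|xi x| ^+ 2.

Definition form (X : Type) (s : seq X) (a : mat X) (eta xi : X -> C) : C :=
  \sum_(x <- s) \sum_(x' <- s) (eta x)^* * a x x' * xi x'.

(* ||a|| <= M as an operator on l2(X): tested on finitely supported vectors
   (which are dense), via |<eta, a xi>| <= M for unit eta, xi. *)
Definition opnorm_le (X : eqType) (a : mat X) (M : C) : Prop :=
  forall (s : seq X) (eta xi : X -> C), uniq s ->
    sqnorm s xi <= 1 -> sqnorm s eta <= 1 -> `|form s a eta xi| <= M.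

Definition bounded_mat (X : eqType) (a : mat X) : Prop :=
  exists M : C, opnorm_le a M.

Definition propagation_le (X : Type) (d : X -> X -> R) (a : mat X) (r : R) :=
  forall x x', a x x' != 0 -> d x x' <= r.

Definition finite_propagation (X : Type) (d : X -> X -> R) (a : mat X) :=
  (exists r : R, propagation_le d a r) /\
  (exists M : R, forall x x', `|a x x'| <= M%:C).

Definition uroe (X : eqType) (d : X -> X -> R) (a : mat X) : Prop :=
  bounded_mat a /\
  forall eps : R, 0 < eps -> exists b : mat X,
    finite_propagation d b /\ opnorm_le (fun x x' => a x x' - b x x') eps%:C.

Definition madd (X : Type) (a b : mat X) : mat X := fun x x' => a x x' + b x x'.
Definition mscale (X : Type) (l : C) (a : mat X) : mat X := fun x x' => l * a x x'.
Definition madj (X : Type) (a : mat X) : mat X := fun x x' => (a x' x)^*.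

(* c = a b : each entry c x z is the (unconditionally convergent) sum
   sum_y a x y * b y z, i.e. the limit of the net of finite partial sums *)
Definition mmul_rel (X : eqType) (a b c : mat X) : Prop :=
  forall (x z : X) (eps : R), 0 < eps -> exists F0 : seq X,
    forall F : seq X, uniq F -> {subset F0 <= F} ->
      `|\sum_(y <- F) a x y * b y z - c x z| <= eps%:C.

Definition star_iso (X Y : eqType) (dX : X -> X -> R) (dY : Y -> Y -> R)
  (phi : mat X -> mat Y) : Prop :=
  (forall a, uroe dX a -> uroe dY (phi a)) /\
  (forall a b, uroe dX a -> uroe dX b -> phi a = phi b -> a = b) /\
  (forall c, uroe dY c -> exists2 a, uroe dX a & phi a = c) /\
  (forall a b, uroe dX a -> uroe dX b -> phi (madd a b) = madd (phi a) (phi b)) /\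
  (forall l a, uroe dX a -> phi (mscale l a) = mscale l (phi a)) /\
  (forall a, uroe dX a -> phi (madj a) = madj (phi a)) /\
  (forall a b c, uroe dX a -> uroe dX b -> uroe dX c ->
     mmul_rel a b c -> mmul_rel (phi a) (phi b) (phi c)).

Definition uroe_isomorphic (X Y : eqType) (dX : X -> X -> R)
  (dY : Y -> Y -> R) : Prop :=
  exists phi : mat X -> mat Y, star_iso dX dY phi.

End Defs.

(* Main.v *)
From mathcomp Require Import all_boot all_order all_algebra.
From mathcomp Require Import reals complex boolp classical_sets filter topology.
From mathcomp Require Import normedtype finmap ring lra zify.
Require Import Defs.

(** An isomorphism of uniform Roe algebras is spatial: for some matrix [V] with
    orthonormal rows and columns, its inverse [psi] maps the matrix unit at
    [(y, y')] to the rank one operator [v_y v_y'^*], where [v_y] is the row of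
    [V] at [y].  Every [psi (1_S)] lies in the uniform Roe algebra, so a Baire
    category argument over the subsets [S] of [Y] makes these projections
    quasi-local uniformly in [S].

    The idea that replaces property A: for finitely supported [xi] one can
    choose signs with [|| 1_Z (sum_y +-<v_y, xi> v_y) ||^2 >=
    sum_y |<v_y, xi>|^2 || 1_Z v_y ||^2], whereas uniform quasi-locality makes
    the left side small when [Z] is far from the support of [xi].  For
    [xi = delta_x] this gives a uniform lower bound for [sup_y |v_y(x)|]; hence
    each [v_y] is concentrated near a point [g y], and [g] and its dual [f] are
    mutually inverse coarse maps.  For [xi] supported on a finite [A] and
    orthogonal to all [v_y] with [g y] near [A] it gives a contradiction, so
    there are at least [|A|] such [y]: this is Hall's condition.  Hall's theorem
    in both directions and the Cantor-Bernstein argument then produce a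
    bijection close to [f]. *)

Set Implicit Arguments.
Unset Strict Implicit.
Unset Printing Implicit Defensive.
Import Order.TTheory GRing.Theory Num.Theory numFieldNormedType.Exports.
Local Open Scope classical_set_scope.
Local Open Scope ring_scope.
Local Open Scope complex_scope.

(** * Finitely supported vectors *)

Section SquaredModulus.
Variable R : rcfType.
Implicit Types z w : R[i].

Definition sqmod z : R := complex.Re z ^+ 2 + complex.Im z ^+ 2.

Lemma sqmod_ge0 z : 0 <= sqmod z.
Proof. by rewrite addr_ge0 // sqr_ge0. Qed.

Lemma sqmod0 : sqmod 0 = 0.
Proof. by rewrite /sqmod /=; ring. Qed.

Lemma sqmod1 : sqmod 1 = 1.
Proof. by rewrite /sqmod /=; ring. Qed.

Lemma sqmod_real (r : R) : sqmod r%:C = r ^+ 2.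
Proof. by rewrite /sqmod /=; ring. Qed.

Lemma sqmodN z : sqmod (- z) = sqmod z.
Proof. by case: z => a b; rewrite /sqmod /=; ring. Qed.

Lemma sqmod_conj z : sqmod (conjc z) = sqmod z.
Proof. by case: z => a b; rewrite /sqmod /=; ring. Qed.

Lemma sqmodM z w : sqmod (z * w) = sqmod z * sqmod w.
Proof. by case: z w => a b [c d]; rewrite /sqmod /=; ring. Qed.

Lemma sqmodD_le z w : sqmod (z + w) <= 2 * sqmod z + 2 * sqmod w.
Proof.
case: z w => a b [c d]; rewrite /sqmod /=.
have := sqr_ge0 (a - c); have := sqr_ge0 (b - d); nra.
Qed.

Lemma sqmod_eq0 z : (sqmod z == 0) = (z == 0).
Proof. by rewrite paddr_eq0 ?sqr_ge0 // !expf_eq0 /= eq_complex. Qed.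

Lemma mulc_conj z : z * conjc z = (sqmod z)%:C.
Proof.
by case: z => a b; apply/eqP; rewrite eq_complex /sqmod /=; apply/andP; split;
  apply/eqP; ring.
Qed.

Lemma normc_sqmod z : `|z| ^+ 2 = (sqmod z)%:C.
Proof. by rewrite -add_Re2_Im2. Qed.

Lemma normc_le_sqmod z (M : R) : 0 <= M ->
  (`|z| <= M%:C) = (sqmod z <= M ^+ 2).
Proof.
move=> M0; rewrite normc_def lecR.
by rewrite -[RHS]ler_sqrt ?sqr_ge0 // sqrtr_sqr (ger0_norm M0).
Qed.

Lemma ge0_complexE z : 0 <= z -> z = (complex.Re z)%:C.
Proof. by move=> z0; rewrite RRe_real // ger0_real. Qed.

End SquaredModulus.

Lemma big_mem_subset (V : nmodType) (T : eqType) (s t : seq T) (f : T -> V) :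
  uniq s -> uniq t -> {subset s <= t} ->
  \sum_(x <- t | x \in s) f x = \sum_(x <- s) f x.
Proof.
move=> us ut st; rewrite -big_filter; apply: perm_big.
apply: uniq_perm => [||x]; rewrite ?filter_uniq //.
by rewrite mem_filter andb_idr // => /st.
Qed.

Lemma ler_sum_subset (R : numDomainType) (T : eqType) (s t : seq T)
    (f : T -> R) : (forall x, 0 <= f x) -> uniq s -> uniq t ->
  {subset s <= t} -> \sum_(x <- s) f x <= \sum_(x <- t) f x.
Proof.
move=> f0 us ut st; rewrite -(big_mem_subset f us ut st).
by rewrite [leRHS](bigID (mem s)) /= lerDl sumr_ge0.
Qed.

Section FiniteVectors.
Variables (R : rcfType) (T : eqType).
Local Notation C := R[i].
Implicit Types (s t : seq T) (f g : T -> C).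

Definition l2sq s f : R := \sum_(x <- s) sqmod (f x).

Definition inner s f g : C := \sum_(x <- s) conjc (f x) * g x.

Lemma l2sq_ge0 s f : 0 <= l2sq s f.
Proof. by apply: sumr_ge0 => x _; apply: sqmod_ge0. Qed.

Lemma l2sq1 x f : l2sq [:: x] f = sqmod (f x).
Proof. by rewrite /l2sq big_seq1. Qed.

Lemma l2sq_zero s f : {in s, forall x, f x = 0} -> l2sq s f = 0.
Proof. by move=> f0; apply: big1_seq => x /= /f0 ->; rewrite sqmod0. Qed.

Lemma l2sq_eq0 s f : l2sq s f = 0 -> {in s, forall x, f x = 0}.
Proof.
move=> /eqP; rewrite psumr_eq0 => [/allP f0 x /f0|x _]; last exact: sqmod_ge0.
by rewrite sqmod_eq0 => /eqP.
Qed.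

Lemma eq_l2sq s f g : {in s, f =1 g} -> l2sq s f = l2sq s g.
Proof. by move=> fg; apply: eq_big_seq => x /fg ->. Qed.

Lemma l2sqD_le s f g :
  l2sq s (fun x => f x + g x) <= 2 * l2sq s f + 2 * l2sq s g.
Proof.
by rewrite !mulr_sumr -big_split /=; apply: ler_sum => x _; exact: sqmodD_le.
Qed.

Lemma l2sqN s f : l2sq s (fun x => - f x) = l2sq s f.
Proof. by apply: eq_bigr => x _; rewrite sqmodN. Qed.

Lemma l2sqZ s (z : C) f : l2sq s (fun x => z * f x) = sqmod z * l2sq s f.
Proof. by rewrite mulr_sumr; apply: eq_bigr => x _; rewrite sqmodM. Qed.

Lemma l2sq_conj s f : l2sq s (fun x => conjc (f x)) = l2sq s f.
Proof. by apply: eq_bigr => x _; rewrite sqmod_conj. Qed.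

Lemma l2sq_subset s t f : uniq s -> uniq t -> {subset s <= t} ->
  l2sq s f <= l2sq t f.
Proof. by move=> us ut st; apply: ler_sum_subset => // x; apply: sqmod_ge0. Qed.

Lemma l2sq_parallelogram s f g :
  l2sq s (fun x => f x + g x) + l2sq s (fun x => - f x + g x) =
  2 * l2sq s f + 2 * l2sq s g.
Proof.
rewrite /l2sq !mulr_sumr -!big_split /=; apply: eq_bigr => x _.
by case: (f x) (g x) => a b [c d]; rewrite /sqmod /=; ring.
Qed.

Lemma l2sqB s f g : l2sq s (fun x => f x - g x) =
  l2sq s f + l2sq s g - 2 * complex.Re (inner s f g).
Proof.
rewrite /l2sq /inner raddf_sum mulr_sumr -big_split -sumrB /=.
apply: eq_bigr => x _; case: (f x) (g x) => a b [c d].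
by rewrite /sqmod /=; ring.
Qed.

Lemma inner_self s f : inner s f f = (l2sq s f)%:C.
Proof.
by rewrite rmorph_sum; apply: eq_bigr => x _; rewrite mulrC; exact: mulc_conj.
Qed.

Lemma inner_conj s f g : conjc (inner s f g) = inner s g f.
Proof.
rewrite rmorph_sum; apply: eq_bigr => x _.
by rewrite rmorphM /= conjcK mulrC.
Qed.

Lemma innerZl s z f g : inner s (fun x => z * f x) g = conjc z * inner s f g.
Proof.
by rewrite mulr_sumr; apply: eq_bigr => x _; rewrite rmorphM mulrA.
Qed.

Lemma innerZr s z f g : inner s f (fun x => z * g x) = z * inner s f g.
Proof. by rewrite mulr_sumr; apply: eq_bigr => x _; rewrite mulrCA. Qed.

Lemma innerDr s f g h :
  inner s f (fun x => g x + h x) = inner s f g + inner s f h.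
Proof. by rewrite -big_split; apply: eq_bigr => x _; rewrite mulrDr. Qed.

Lemma Re_inner_le s f g :
  complex.Re (inner s f g) <= (l2sq s f + l2sq s g) / 2.
Proof. by have := l2sq_ge0 s (fun x => f x - g x); rewrite l2sqB; lra. Qed.

(* Expand [0 <= || |g|^2 f - <g, f> g ||^2], which is
   [|g|^2 (|f|^2 |g|^2 - |<f, g>|^2)]. *)
Lemma cauchy_schwarz s f g :
  sqmod (inner s f g) <= l2sq s f * l2sq s g.
Proof.
have [g0|g0] := eqVneq (l2sq s g) 0.
  rewrite /inner big1_seq ?sqmod0 ?g0 ?mulr0 // => x /= xs.
  by rewrite (l2sq_eq0 g0) ?mulr0.
have gp : 0 < l2sq s g by rewrite lt_neqAle eq_sym g0 l2sq_ge0.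
have := l2sq_ge0 s (fun x => (l2sq s g)%:C * f x - inner s g f * g x).
rewrite l2sqB !l2sqZ innerZl innerZr sqmod_real (conjc_real (l2sq s g)).
rewrite -(inner_conj s f g) [conjc _ * _]mulrC mulc_conj -rmorphM /= sqmod_conj.
by rewrite -[sqmod _ <= _](ler_pM2l gp); lra.
Qed.

Lemma l2sq_dual s f (K : R) : 0 <= K ->
  (forall g, sqmod (inner s g f) <= K * l2sq s g) -> l2sq s f <= K.
Proof.
move=> K0 /(_ f); rewrite inner_self sqmod_real => fK.
have := l2sq_ge0 s f; rewrite le_eqVlt => /orP[/eqP <- //|f0].
by rewrite -(ler_pM2r f0) -expr2.
Qed.

End FiniteVectors.

(** * Sums over finite subsets *)

Section ComplexConvergence.
Variables (R : realType) (T : Type) (F : set_system T).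
Context {FF : ProperFilter F}.
Local Notation C := R[i].
Implicit Types (f g : T -> C) (k l : C).

(* Coordinatewise, as [R[i]] carries no canonical topology. *)
Definition cvgc f l : Prop :=
  complex.Re (f t) @[t --> F] --> complex.Re l /\
  complex.Im (f t) @[t --> F] --> complex.Im l.

Lemma cvgc_unique f k l : cvgc f k -> cvgc f l -> k = l.
Proof.
move=> [fk fk'] [fl fl']; apply/eqP; rewrite eq_complex.
by rewrite (norm_cvg_unique fk fl) (norm_cvg_unique fk' fl') !eqxx.
Qed.

Lemma near_eq_cvgc f g l : (\forall t \near F, f t = g t) ->
  cvgc f l -> cvgc g l.
Proof.
move=> fg [fl fl']; split.
  by apply: cvg_trans fl; apply: near_eq_cvg; apply: filterS fg => t ->.
by apply: cvg_trans fl'; apply: near_eq_cvg; apply: filterS fg => t ->.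
Qed.

Lemma cvgc_cst l : cvgc (fun=> l) l.
Proof. by split; apply: cvg_cst. Qed.

Lemma cvgcD f g k l : cvgc f k -> cvgc g l -> cvgc (fun t => f t + g t) (k + l).
Proof.
move=> [fk fk'] [gl gl']; split; rewrite raddfD;
  under eq_fun do rewrite raddfD; exact: cvgD.
Qed.

Lemma cvgcM f g k l : cvgc f k -> cvgc g l -> cvgc (fun t => f t * g t) (k * l).
Proof.
have ReM (z w : C) : complex.Re (z * w) =
    complex.Re z * complex.Re w - complex.Im z * complex.Im w.
  by case: z w => ? ? [].
have ImM (z w : C) : complex.Im (z * w) =
    complex.Re z * complex.Im w + complex.Im z * complex.Re w.
  by case: z w => ? ? [].
move=> [fk fk'] [gl gl']; split.
  by rewrite ReM; under eq_fun do rewrite ReM; apply: cvgB; apply: cvgM.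
by rewrite ImM; under eq_fun do rewrite ImM; apply: cvgD; apply: cvgM.
Qed.

Lemma cvgcMl z f l : cvgc f l -> cvgc (fun t => z * f t) (z * l).
Proof. exact/cvgcM/cvgc_cst. Qed.

Lemma cvgcMr z f l : cvgc f l -> cvgc (fun t => f t * z) (l * z).
Proof. by move=> fl; apply: cvgcM fl (cvgc_cst z). Qed.

Lemma cvgcB f g k l : cvgc f k -> cvgc g l -> cvgc (fun t => f t - g t) (k - l).
Proof.
move=> fk gl; rewrite -mulN1r; under eq_fun do rewrite -mulN1r.
exact/cvgcD/cvgcMl.
Qed.

Lemma cvgc_sum (I : Type) (s : seq I) (f : I -> T -> C) (l : I -> C) :
  (forall i, cvgc (f i) (l i)) ->
  cvgc (fun t => \sum_(i <- s) f i t) (\sum_(i <- s) l i).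
Proof.
move=> fl; split; rewrite raddf_sum; under eq_fun do rewrite raddf_sum;
  by apply: cvg_big => [|i _]; [exact: add_continuous | case: (fl i)].
Qed.

Lemma cvg_sqmod f l : cvgc f l -> sqmod (f t) @[t --> F] --> sqmod l.
Proof. by move=> [fl fl']; apply: cvgD; apply: cvgM. Qed.

Lemma cvg_l2sq (I : eqType) (s : seq I) (f : T -> I -> C) (l : I -> C) :
  (forall i, cvgc (f^~ i) (l i)) -> l2sq s (f t) @[t --> F] --> l2sq s l.
Proof.
move=> fl; apply: cvg_big => [|i _]; first exact: add_continuous.
exact: cvg_sqmod.
Qed.

Lemma cvgc_normP f l : cvgc f l <->
  forall e : R, 0 < e -> \forall t \near F, `|f t - l| <= e%:C.
Proof.
split=> [[fl fl'] e e0|fl].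
  have e2 : 0 < e / 2 by lra.
  move/cvgrPdist_le: fl => /(_ _ e2) fl; move/cvgrPdist_le: fl' => /(_ _ e2).
  apply: filterS2 fl => t; rewrite normc_le_sqmod ?(ltW e0) //.
  rewrite /sqmod !raddfB /=.
  rewrite !ler_norml => /andP[? ?] /andP[? ?]; nra.
split; apply/cvgrPdist_le => e e0; apply: filterS (fl e e0) => t;
  rewrite normc_le_sqmod ?(ltW e0) // distrC -raddfB => ft;
  rewrite -(ler_pXn2r (n := 2)) ?nnegrE ?(ltW e0) // real_normK ?num_real //;
  apply: le_trans ft.
  by rewrite lerDl sqr_ge0.
by rewrite lerDr sqr_ge0.
Qed.

End ComplexConvergence.

Section ExhaustingFilter.
Variable T : eqType.
Implicit Types (x : T) (s G : seq T).

(* Limits along this filter are those of the net of finite subsets of [T], a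
   finite subset being given by a duplicate-free list. *)
Definition exhausting : set_system (seq T) :=
  [set P | exists G0, forall G, uniq G -> {subset G0 <= G} -> P G].

Global Instance exhausting_filter : ProperFilter exhausting.
Proof.
split.
  move=> [G0 /(_ (undup G0) (undup_uniq _))]; apply=> x.
  by rewrite mem_undup.
split=> [|P Q [G0 PG] [G1 QG]|P Q PQ [G0 PG]].
- by exists [::].
- exists (G0 ++ G1) => G uG sG.
  by split; [apply: PG | apply: QG] => // x xG; apply: sG;
    rewrite mem_cat xG ?orbT.
- by exists G0 => G uG sG; apply/PQ/PG.
Qed.

Lemma exhausting_uniq : \forall G \near exhausting, uniq G.
Proof. by exists [::]. Qed.

Lemma exhausting_subset s : \forall G \near exhausting, {subset s <= G}.
Proof. by exists s. Qed.

Lemma exhausting_mem x : \forall G \near exhausting, x \in G.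
Proof. by exists [:: x] => G _; apply; rewrite mem_head. Qed.

End ExhaustingFilter.
Arguments exhausting : clear implicits.

Section NetSums.
Variables (R : realType) (T : eqType).
Local Notation C := R[i].
Implicit Types (f g : T -> C) (s F : seq T) (k l : C).

Definition net_sum f l : Prop :=
  cvgc (exhausting T) (fun F => \sum_(x <- F) f x) l.

Lemma net_sum_unique f k l : net_sum f k -> net_sum f l -> k = l.
Proof. exact: cvgc_unique. Qed.

Lemma net_sumB f g k l : net_sum f k -> net_sum g l ->
  net_sum (fun x => f x - g x) (k - l).
Proof.
move=> fk gl; rewrite /net_sum; under eq_fun do rewrite sumrB.
exact: cvgcB.
Qed.

Lemma net_sum_single f x : (forall y, y != x -> f y = 0) -> net_sum f (f x).
Proof.
move=> f0; apply: (near_eq_cvgc (f := fun=> f x)); last exact: cvgc_cst.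
have := exhausting_mem x; apply: filterS2 (exhausting_uniq T) => F uF xF.
by rewrite (bigD1_seq x) //= big1 ?addr0.
Qed.

Lemma l2sq_le_lim f (l : R) s : uniq s ->
  l2sq F f @[F --> exhausting T] --> l -> l2sq s f <= l.
Proof.
move=> us fl; apply: (cvgr_to_ge fl).
have := exhausting_subset s; apply: filterS2 (exhausting_uniq T) => F uF sF.
exact: l2sq_subset.
Qed.

Lemma l2sq_bounded_cvg f (B : R) : (forall F, uniq F -> l2sq F f <= B) ->
  exists l : R, l2sq F f @[F --> exhausting T] --> l.
Proof.
move=> fB; pose S := [set l2sq F f | F in [set F | uniq F]].
have supS : has_sup S.
  split; first by exists (l2sq [::] f), [::].
  by exists B => _ [F uF <-]; apply: fB.
exists (sup S); apply/cvgrPdist_le => e e0.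
have [_ [F0 uF0 <-] F0e] := sup_adherent e0 supS.
have := exhausting_subset F0; apply: filterS2 (exhausting_uniq T) => F uF sF.
have lo : l2sq F0 f <= l2sq F f by apply: l2sq_subset.
have up : l2sq F f <= sup S by apply: sup_upper_bound => //; exists F.
rewrite ger0_norm; lra.
Qed.

(* The inner product polarizes into squared norms. *)
Lemma cvg_Re_sum_mul f g (A B : R) :
  (forall F, uniq F -> l2sq F f <= A) -> (forall F, uniq F -> l2sq F g <= B) ->
  exists r : R,
    complex.Re (\sum_(x <- F) f x * g x) @[F --> exhausting T] --> r.
Proof.
move=> fA gB.
have [lf cf] := l2sq_bounded_cvg fA; have [lg cg] := l2sq_bounded_cvg gB.
have [|ld cd] := @l2sq_bounded_cvg (fun x => conjc (f x) - g x)
  (2 * A + 2 * B).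
  move=> F uF; apply: le_trans (l2sqD_le _ _ _) _.
  by rewrite l2sqN l2sq_conj lerD // ler_wpM2l // ?fA ?gB.
exists ((lf + lg - ld) * 2^-1).
have -> : (fun F => complex.Re (\sum_(x <- F) f x * g x)) = (fun F =>
    (l2sq F f + l2sq F g - l2sq F (fun x => conjc (f x) - g x)) * 2^-1).
  apply/funext => F; rewrite l2sqB l2sq_conj /inner.
  under [in RHS]eq_bigr do rewrite conjcK.
  by field.
by apply: cvgM (cvg_cst _); apply: cvgB cd; apply: cvgD.
Qed.

Lemma net_sum_exists f g (A B : R) :
  (forall F, uniq F -> l2sq F f <= A) -> (forall F, uniq F -> l2sq F g <= B) ->
  exists l, net_sum (fun x => f x * g x) l.
Proof.
move=> fA gB; have [lr cr] := cvg_Re_sum_mul fA gB.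
have [|li ci] := @cvg_Re_sum_mul f (fun x => 'i%C * g x) A B fA.
  by move=> F uF; rewrite l2sqZ /sqmod /= expr0n expr1n add0r mul1r gB.
exists (lr +i* - li); split=> //=.
have -> : (fun F => complex.Im (\sum_(x <- F) f x * g x)) =
    (fun F => - complex.Re (\sum_(x <- F) f x * ('i%C * g x))).
  apply/funext => F; under [in RHS]eq_bigr do rewrite mulrCA mulrC.
  by rewrite -mulr_suml ReiNIm opprK.
exact: cvgN.
Qed.

End NetSums.

(** * Matrices as operators *)

Section Operators.
Variables (R : realType) (X : eqType).
Local Notation C := R[i].
Implicit Types (a b c : mat R X) (s t : seq X) (xi eta : X -> C).

Definition msub a b : mat R X := fun x z => a x z - b x z.

Definition mapply t a xi : X -> C := fun x => \sum_(z <- t) a x z * xi z.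

(* [K] bounds the square of the operator norm. *)
Definition opsq_le a (K : R) : Prop := forall s t xi, uniq s -> uniq t ->
  l2sq s (mapply t a xi) <= K * l2sq t xi.

Definition far_apart (d : X -> X -> R) (r : R) s t : Prop :=
  forall x z, x \in s -> z \in t -> r < d x z.

(* The corner [1_s a 1_t] has squared norm at most [K] as soon as [s] and [t]
   are at distance more than [r]. *)
Definition quasi_local (d : X -> X -> R) a (K r : R) : Prop :=
  forall s t xi, uniq s -> uniq t -> far_apart d r s t ->
  l2sq s (mapply t a xi) <= K * l2sq t xi.

Lemma mapply1 z a xi x : mapply [:: z] a xi x = a x z * xi z.
Proof. by rewrite /mapply big_seq1. Qed.

Lemma mapplyD t a b xi x :
  mapply t (madd a b) xi x = mapply t a xi x + mapply t b xi x.
Proof. by rewrite -big_split; apply: eq_bigr => z _; apply: mulrDl. Qed.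

Lemma mapplyB t a b xi x :
  mapply t (msub a b) xi x = mapply t a xi x - mapply t b xi x.
Proof. by rewrite -sumrB; apply: eq_bigr => z _; apply: mulrBl. Qed.

Lemma mapplyZl t l a xi x : mapply t (mscale l a) xi x = l * mapply t a xi x.
Proof. by rewrite mulr_sumr; apply: eq_bigr => z _; rewrite mulrA. Qed.

Lemma mapplyZr t l a xi :
  mapply t a (fun z => l * xi z) = fun x => l * mapply t a xi x.
Proof.
apply/funext => x.
by rewrite mulr_sumr; apply: eq_bigr => z _; rewrite mulrCA.
Qed.

Lemma inner_madj s t a eta xi :
  inner s eta (mapply t (madj a) xi) = inner t (mapply s a eta) xi.
Proof.
rewrite /inner /mapply; under eq_bigr do rewrite mulr_sumr.
rewrite exchange_big /=; apply: eq_bigr => z _.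
rewrite rmorph_sum mulr_suml; apply: eq_bigr => x _.
by rewrite rmorphM /= mulrA [conjc _ * _]mulrC.
Qed.

Lemma sqnormE s xi : sqnorm s xi = (l2sq s xi)%:C.
Proof. by rewrite rmorph_sum; apply: eq_bigr => x _; exact: normc_sqmod. Qed.

Lemma formE s a eta xi : form s a eta xi = inner s eta (mapply s a xi).
Proof.
apply: eq_bigr => x _; rewrite mulr_sumr.
by apply: eq_bigr => z _; rewrite mulrA.
Qed.

Lemma opnorm_le_ge0 a (M : C) : opnorm_le a M -> 0 <= M.
Proof.
move=> /(_ [::] (fun=> 0) (fun=> 0) isT).
by rewrite /sqnorm /form !big_nil ler01 normr0; apply.
Qed.

Lemma opnorm_le_real_ge0 a (M : R) : opnorm_le a M%:C -> 0 <= M.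
Proof. by move/opnorm_le_ge0; rewrite ler0c. Qed.

Lemma opnorm_leW a (M N : C) : M <= N -> opnorm_le a M -> opnorm_le a N.
Proof.
by move=> MN aM s eta xi us xi1 eta1; apply: le_trans (aM _ _ _ _ _ _) MN.
Qed.

Lemma opnorm_leD a b (M N : C) :
  opnorm_le a M -> opnorm_le b N -> opnorm_le (madd a b) (M + N).
Proof.
move=> aM bN s eta xi us xi1 eta1.
have -> : form s (madd a b) eta xi = form s a eta xi + form s b eta xi.
  rewrite !formE -innerDr; apply: eq_bigr => x _; by rewrite mapplyD.
by rewrite (le_trans (ler_normD _ _)) // lerD ?aM ?bN.
Qed.

Lemma opnorm_leZ l a (M : C) :
  opnorm_le a M -> opnorm_le (mscale l a) (`|l| * M).
Proof.
move=> aM s eta xi us xi1 eta1; rewrite !formE.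
have -> : inner s eta (mapply s (mscale l a) xi) =
    l * inner s eta (mapply s a xi).
  by rewrite -innerZr; apply: eq_bigr => x _; rewrite mapplyZl.
by rewrite normrM ler_wpM2l // -formE aM.
Qed.

Lemma opnorm_leB a b (M N : C) :
  opnorm_le a M -> opnorm_le b N -> opnorm_le (msub a b) (M + N).
Proof.
move=> aM /(opnorm_leZ (-1)); rewrite normrN1 mul1r => /(opnorm_leD aM).
suff -> : madd a (mscale (-1) b) = msub a b by [].
by apply/funext => x; apply/funext => z; rewrite /madd /mscale mulN1r.
Qed.

Lemma opnorm_le_adj a (M : C) : opnorm_le a M -> opnorm_le (madj a) M.
Proof.
move=> aM s eta xi us xi1 eta1.
by rewrite formE inner_madj -inner_conj normcJ -formE aM.
Qed.

Lemma opnorm_le_inner a (M : R) s eta xi : opnorm_le a M%:C -> uniq s ->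
  sqmod (inner s eta (mapply s a xi)) <= M ^+ 2 * (l2sq s eta * l2sq s xi).
Proof.
move=> aM us; have M0 := opnorm_le_real_ge0 aM.
have [e0|e0] := eqVneq (l2sq s eta) 0.
  rewrite /inner big1_seq ?sqmod0 ?e0 ?mul0r ?mulr0 // => x /= xs.
  by rewrite (l2sq_eq0 e0) // conjc0 mul0r.
have [x0|x0] := eqVneq (l2sq s xi) 0.
  rewrite /inner big1 ?sqmod0 ?x0 ?mulr0 // => x _.
  rewrite /mapply big1_seq ?mulr0 // => z /= zs.
  by rewrite (l2sq_eq0 x0) ?mulr0.
have normalized f : l2sq s f != 0 ->
    (Num.sqrt (l2sq s f))^-1 ^+ 2 * l2sq s f = 1.
  by move=> f0; rewrite exprVn sqr_sqrtr ?l2sq_ge0 // mulVf.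
set A := (Num.sqrt (l2sq s eta))^-1; set B := (Num.sqrt (l2sq s xi))^-1.
have AE : A ^+ 2 * l2sq s eta = 1 by apply: normalized.
have BE : B ^+ 2 * l2sq s xi = 1 by apply: normalized.
have := aM s (fun x => A%:C * eta x) (fun x => B%:C * xi x) us.
rewrite !sqnormE !l2sqZ !sqmod_real AE BE lexx => /(_ isT isT).
rewrite normc_le_sqmod // formE innerZl mapplyZr innerZr.
rewrite !sqmodM sqmod_conj !sqmod_real => normalized_le.
have P0 : 0 <= l2sq s eta * l2sq s xi by rewrite mulr_ge0 ?l2sq_ge0.
have := ler_wpM2r P0 normalized_le; set Z := sqmod _.
have -> : A ^+ 2 * (B ^+ 2 * Z) * (l2sq s eta * l2sq s xi) =
  (A ^+ 2 * l2sq s eta) * (B ^+ 2 * l2sq s xi) * Z by ring.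
by rewrite AE BE !mul1r.
Qed.

Definition zero_ext s xi : X -> C := fun x => if x \in s then xi x else 0.

Lemma l2sq_zero_ext s t xi : uniq s -> uniq t -> {subset s <= t} ->
  l2sq t (zero_ext s xi) = l2sq s xi.
Proof.
move=> us ut st; rewrite /l2sq -(big_mem_subset _ us ut st) [RHS]big_mkcond.
by apply: eq_bigr => x _; rewrite /zero_ext; case: ifP => // _; rewrite sqmod0.
Qed.

Lemma inner_zero_ext s t eta xi : uniq s -> uniq t -> {subset s <= t} ->
  inner t (zero_ext s eta) xi = inner s eta xi.
Proof.
move=> us ut st; rewrite /inner -(big_mem_subset _ us ut st) [RHS]big_mkcond.
apply: eq_bigr => x _; rewrite /zero_ext.
by case: ifP => // _; rewrite conjc0 mul0r.
Qed.

Lemma mapply_zero_ext s t a xi x : uniq s -> uniq t -> {subset s <= t} ->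
  mapply t a (zero_ext s xi) x = mapply s a xi x.
Proof.
move=> us ut st; rewrite /mapply -(big_mem_subset _ us ut st) [RHS]big_mkcond.
by apply: eq_bigr => z _; rewrite /zero_ext; case: ifP => // _; rewrite mulr0.
Qed.

Lemma opnorm_le_opsq a (M : R) :
  0 <= M -> opnorm_le a M%:C <-> opsq_le a (M ^+ 2).
Proof.
move=> M0; split=> [aM s t xi us ut|aM s eta xi us].
  apply: l2sq_dual => [|eta]; first by rewrite mulr_ge0 ?sqr_ge0 ?l2sq_ge0.
  have uu : uniq (undup (s ++ t)) by apply: undup_uniq.
  have su : {subset s <= undup (s ++ t)}.
    by move=> x xs; rewrite mem_undup mem_cat xs.
  have tu : {subset t <= undup (s ++ t)}.
    by move=> x xs; rewrite mem_undup mem_cat xs orbT.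
  have := opnorm_le_inner (zero_ext s eta) (zero_ext t xi) aM uu.
  rewrite !l2sq_zero_ext // inner_zero_ext // mulrA mulrAC.
  by congr (sqmod _ <= _); apply: eq_bigr => x _; rewrite mapply_zero_ext.
rewrite !sqnormE (lecR _ 1) (lecR _ 1) => xi1 eta1.
rewrite normc_le_sqmod // formE; apply: le_trans (cauchy_schwarz _ _ _) _.
have := aM s s xi us us; have := l2sq_ge0 s xi; have := l2sq_ge0 s eta.
have := l2sq_ge0 s (mapply s a xi); have := sqr_ge0 M; nra.
Qed.

Lemma opsq_le_opnorm a (K : R) :
  0 <= K -> opsq_le a K <-> opnorm_le a (Num.sqrt K)%:C.
Proof. by move=> K0; rewrite opnorm_le_opsq ?sqrtr_ge0 // sqr_sqrtr. Qed.

Lemma opsq_le_adj a K : 0 <= K -> opsq_le a K -> opsq_le (madj a) K.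
Proof. by move=> K0; rewrite !opsq_le_opnorm //; apply: opnorm_le_adj. Qed.

Lemma opsq_entry a K x z : opsq_le a K -> sqmod (a x z) <= K.
Proof.
move=> /(_ [:: x] [:: z] (fun=> 1) isT isT).
by rewrite !l2sq1 mapply1 sqmod1 !mulr1.
Qed.

Lemma opsq_col a K s z : opsq_le a K -> uniq s -> l2sq s (a^~ z) <= K.
Proof.
move=> aK us; have := aK s [:: z] (fun=> 1) us isT.
rewrite l2sq1 sqmod1 mulr1 (eq_l2sq (g := a^~ z)) // => x _.
by rewrite mapply1 mulr1.
Qed.

Lemma opsq_row a K s x : 0 <= K -> opsq_le a K -> uniq s -> l2sq s (a x) <= K.
Proof.
by move=> K0 aK us; rewrite -l2sq_conj; apply: opsq_col (opsq_le_adj K0 aK) us.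
Qed.

Lemma quasi_local_le d a K L r r' : K <= L -> r <= r' ->
  quasi_local d a K r -> quasi_local d a L r'.
Proof.
move=> KL rr aK s t xi us ut st; apply: le_trans (aK _ _ _ us ut _) _.
  by move=> x z xs zt; apply: le_lt_trans rr _; apply: st.
by rewrite ler_wpM2r // l2sq_ge0.
Qed.

Lemma quasi_localD d a b K L r : quasi_local d a K r -> quasi_local d b L r ->
  quasi_local d (madd a b) (2 * K + 2 * L) r.
Proof.
move=> aK bL s t xi us ut st.
rewrite (eq_l2sq (fun x _ => mapplyD t a b xi x)).
apply: le_trans (l2sqD_le _ _ _) _.
have := aK s t xi us ut st; have := bL s t xi us ut st; lra.
Qed.

Lemma quasi_localB d a b K L r : quasi_local d a K r -> quasi_local d b L r ->
  quasi_local d (msub a b) (2 * K + 2 * L) r.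
Proof.
move=> aK bL s t xi us ut st.
rewrite (eq_l2sq (fun x _ => mapplyB t a b xi x)).
apply: le_trans (l2sqD_le _ _ _) _; rewrite l2sqN.
have := aK s t xi us ut st; have := bL s t xi us ut st; lra.
Qed.

Lemma quasi_local_entry d a K r x z :
  quasi_local d a K r -> r < d x z -> sqmod (a x z) <= K.
Proof.
move=> aK dxz; have := aK [:: x] [:: z] (fun=> 1) isT isT.
rewrite !l2sq1 mapply1 sqmod1 !mulr1; apply.
by move=> ? ?; rewrite !inE => /eqP -> /eqP ->.
Qed.

End Operators.

Section Products.
Variables (R : realType) (X : eqType).
Local Notation C := R[i].
Implicit Types (a b c q : mat R X) (s t F : seq X) (xi : X -> C).

Lemma mmul_relP a b c : mmul_rel a b c <->
  forall x z, net_sum (fun y => a x y * b y z) (c x z).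
Proof.
split=> [abc x z|abc x z e e0]; first by apply/cvgc_normP; apply: abc.
by have /cvgc_normP /(_ e e0) := abc x z.
Qed.

Lemma mmul_unique a b c c' : mmul_rel a b c -> mmul_rel a b c' -> c = c'.
Proof.
move=> /mmul_relP abc /mmul_relP abc'; apply/funext => x; apply/funext => z.
exact: net_sum_unique (abc x z) (abc' x z).
Qed.

Lemma mmul_exists a b (A B : R) : opnorm_le a A%:C -> opnorm_le b B%:C ->
  exists c, mmul_rel a b c.
Proof.
move=> aA bB.
have A0 := opnorm_le_real_ge0 aA; have B0 := opnorm_le_real_ge0 bB.
move: aA bB; rewrite !opnorm_le_opsq // => aA bB.
have entry xz : exists l, net_sum (fun y => a xz.1 y * b y xz.2) l.
  apply: (net_sum_exists (A := A ^+ 2) (B := B ^+ 2)) => F uF.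
    exact: opsq_row (sqr_ge0 A) aA uF.
  exact: opsq_col bB uF.
have [c abc] := choice entry.
by exists (fun x z => c (x, z)); apply/mmul_relP => x z; apply: (abc (x, z)).
Qed.

Lemma mmulBr a b b' c c' : mmul_rel a b c -> mmul_rel a b' c' ->
  mmul_rel a (msub b b') (msub c c').
Proof.
move=> /mmul_relP abc /mmul_relP abc'; apply/mmul_relP => x z.
have := net_sumB (abc x z) (abc' x z); congr net_sum.
by apply/funext => y; rewrite mulrBr.
Qed.

Lemma mmulBl a a' b c c' : mmul_rel a b c -> mmul_rel a' b c' ->
  mmul_rel (msub a a') b (msub c c').
Proof.
move=> /mmul_relP abc /mmul_relP abc'; apply/mmul_relP => x z.
have := net_sumB (abc x z) (abc' x z); congr net_sum.
by apply/funext => y; rewrite mulrBl.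
Qed.

Lemma mmul_mapply_cvg a b c t xi x : mmul_rel a b c ->
  cvgc (exhausting X) (fun F => mapply F a (mapply t b xi) x) (mapply t c xi x).
Proof.
move=> /mmul_relP abc.
have -> : (fun F => mapply F a (mapply t b xi) x) =
    (fun F => \sum_(z <- t) (\sum_(y <- F) a x y * b y z) * xi z).
  apply/funext => F; rewrite /mapply; under eq_bigr do rewrite mulr_sumr.
  rewrite exchange_big /=; apply: eq_bigr => z _; rewrite mulr_suml.
  by apply: eq_bigr => y _; rewrite mulrA.
by apply: cvgc_sum => z; apply: cvgcMr; apply: abc.
Qed.

Lemma mmul_l2sq_le a b c s t xi (Q : R) : mmul_rel a b c ->
  (forall F, uniq F -> l2sq s (mapply F a (mapply t b xi)) <= Q) ->
  l2sq s (mapply t c xi) <= Q.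
Proof.
move=> abc abQ.
have cvg_ab : l2sq s (mapply F a (mapply t b xi)) @[F --> exhausting X] -->
    l2sq s (mapply t c xi).
  by apply: cvg_l2sq => x; apply: mmul_mapply_cvg.
apply: (cvgr_to_le cvg_ab).
by apply: filterS (exhausting_uniq X) => F; apply: abQ.
Qed.

Lemma opsq_leM a b c A B : 0 <= A -> opsq_le a A -> opsq_le b B ->
  mmul_rel a b c -> opsq_le c (A * B).
Proof.
move=> A0 aA bB abc s t xi us ut; apply: mmul_l2sq_le abc _ => F uF.
apply: le_trans (aA _ _ _ us uF) _; rewrite -mulrA ler_wpM2l //.
exact: bB.
Qed.

Lemma opnorm_leM a b c (A B : R) : opnorm_le a A%:C -> opnorm_le b B%:C ->
  mmul_rel a b c -> opnorm_le c (A * B)%:C.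
Proof.
move=> aA bB abc.
have A0 := opnorm_le_real_ge0 aA; have B0 := opnorm_le_real_ge0 bB.
apply/opnorm_le_opsq; rewrite ?mulr_ge0 // exprMn.
by apply: opsq_leM (sqr_ge0 A) _ _ abc; apply/opnorm_le_opsq.
Qed.

Lemma quasi_localM d a b c A B K L r r' : is_metric d -> 0 <= A -> 0 <= K ->
  opsq_le a A -> opsq_le b B -> quasi_local d a K r -> quasi_local d b L r' ->
  mmul_rel a b c -> quasi_local d c (2 * (K * B) + 2 * (A * L)) (r + r').
Proof.
move=> [_ [_ [_ tri]]] A0 K0 aA bB aK bL abc s t xi us ut st.
apply: mmul_l2sq_le abc _ => F uF; set eta := mapply t b xi.
pose far y := all (fun x => r < d x y) s.
have uf (p : pred X) : uniq [seq y <- F | p y] by apply: filter_uniq.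
have split_far x : mapply F a eta x =
    mapply [seq y <- F | far y] a eta x +
      mapply [seq y <- F | ~~ far y] a eta x.
  by rewrite /mapply (bigID far) !big_filter.
rewrite (eq_l2sq (fun x _ => split_far x)).
apply: le_trans (l2sqD_le _ _ _) _.
have far_le : l2sq s (mapply [seq y <- F | far y] a eta) <= K * (B * l2sq t xi).
  apply: le_trans (ler_wpM2l K0 (bB _ _ xi (uf far) ut)).
  apply: aK => // x y xs; rewrite mem_filter => /andP[/allP yf _].
  exact: yf.
have near_le : l2sq s (mapply [seq y <- F | ~~ far y] a eta) <=
    A * (L * l2sq t xi).
  apply: le_trans (aA _ _ _ us (uf _)) _; rewrite ler_wpM2l //.
  apply: bL => // y z; rewrite mem_filter => /andP[/allPn[x xs]].
  rewrite -leNgt => dxy _ zt; have := st x z xs zt; have := tri x y z; lra.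
lra.
Qed.

Definition projection q : Prop := madj q = q /\ mmul_rel q q q.

(* With [eta = q xi] one has [|| eta ||^2 = <xi, q xi>], which is at most
   [(|| xi ||^2 + || eta ||^2) / 2]. *)
Lemma projection_contraction q : projection q -> opsq_le q 1.
Proof.
move=> [qadj qq] s t xi us ut; rewrite mul1r.
pose eta := mapply t q xi.
have eta_sum F : complex.Re (inner t xi (mapply F q eta)) = l2sq F eta.
  by rewrite -{1}qadj inner_madj inner_self.
have eta_cvg : l2sq F eta @[F --> exhausting X] -->
    complex.Re (inner t xi eta).
  under eq_fun do rewrite -eta_sum.
  have [] // : cvgc (exhausting X) (fun F => inner t xi (mapply F q eta))
      (inner t xi eta).
  apply: cvgc_sum => x; apply: cvgcMl; exact: mmul_mapply_cvg qq.
have := l2sq_le_lim us eta_cvg; have := l2sq_le_lim ut eta_cvg.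
have := Re_inner_le t xi eta; lra.
Qed.

Lemma projection_diag_real q x : projection q ->
  q x x = (complex.Re (q x x))%:C.
Proof.
move=> [/(congr1 (fun m => m x x)) + _]; rewrite /madj.
case: (q x x) => r i /= [/eqP]; rewrite eq_sym -addr_eq0 -mulr2n mulrn_eq0.
by move/eqP ->.
Qed.

Lemma projection_col_cvg q x : projection q ->
  l2sq F (q^~ x) @[F --> exhausting X] --> complex.Re (q x x).
Proof.
move=> [qadj /mmul_relP/(_ x x)[qq _]].
suff -> : (fun F => l2sq F (q^~ x)) =
    (fun F => complex.Re (\sum_(y <- F) q x y * q y x)) by [].
apply/funext => F; rewrite raddf_sum; apply: eq_bigr => y _ /=.
have -> : q x y = conjc (q y x) by rewrite -[in LHS]qadj.
by rewrite mulrC mulc_conj.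
Qed.

Lemma projection_diag_ge0 q x : projection q -> 0 <= complex.Re (q x x).
Proof.
move=> /(projection_col_cvg (x := x)) /(l2sq_le_lim (isT : uniq [::])).
by rewrite /l2sq big_nil.
Qed.

Lemma projection_entry_le q x z : projection q ->
  sqmod (q x z) <= complex.Re (q z z).
Proof.
move=> /(projection_col_cvg (x := z)) /(l2sq_le_lim (isT : uniq [:: x])).
by rewrite l2sq1.
Qed.

End Products.

(** * The uniform Roe algebra *)

Section Metrics.
Variables (R : realType) (X : Type) (d : X -> X -> R).
Hypothesis dm : is_metric d.

Lemma is_metric_refl x : d x x = 0.
Proof. by case: dm. Qed.

Lemma is_metric_sym x y : d x y = d y x.
Proof. by case: dm => _ [_ []]. Qed.

Lemma is_metric_triangle x y z : d x z <= d x y + d y z.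
Proof. by case: dm => _ [_ []]. Qed.

End Metrics.

Section SparseMatrices.
Variables (R : realType) (X : eqType).
Implicit Types (b : mat R X) (s : seq X) (f : X -> R[i]).

Lemma l2sq_le_size s f (M : R) : (forall x, sqmod (f x) <= M) ->
  l2sq s f <= (size s)%:R * M.
Proof.
move=> fM; apply: le_trans (ler_sum _ (fun x _ => fM x)) _.
by rewrite big_const_seq count_predT iter_addr_0 mulr_natl.
Qed.

Lemma sparse_opsq_le b (M : R) (N : nat) : 0 <= M ->
  (forall x z, sqmod (b x z) <= M) ->
  (forall x s, uniq s -> {in s, forall z, b x z != 0} -> (size s <= N)%N) ->
  (forall z s, uniq s -> {in s, forall x, b x z != 0} -> (size s <= N)%N) ->
  opsq_le b (N%:R * M * N%:R).
Proof.
move=> M0 bM rowN colN s t xi us ut.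
have row_le x : sqmod (mapply t b xi x) <=
    N%:R * M * \sum_(z <- t | b x z != 0) sqmod (xi z).
  pose t' := [seq z <- t | b x z != 0].
  have -> : mapply t b xi x = inner t' (fun z => conjc (b x z)) xi.
    rewrite /mapply /inner big_filter [RHS]big_mkcond; apply: eq_bigr => z _.
    by rewrite conjcK; case: eqVneq => // ->; rewrite mul0r.
  apply: le_trans (cauchy_schwarz _ _ _) _.
  rewrite -big_filter -/(l2sq _ xi) l2sq_conj ler_wpM2r ?l2sq_ge0 //.
  apply: le_trans (l2sq_le_size t' (bM x)) _; rewrite ler_wpM2r // ler_nat.
  by apply: (rowN x) => [|z]; rewrite ?filter_uniq // mem_filter => /andP[].
apply: le_trans (ler_sum _ (fun x _ => row_le x)) _.
rewrite -mulr_sumr -[leRHS]mulrA ler_wpM2l ?mulr_ge0 //.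
under eq_bigr do rewrite big_mkcond.
rewrite exchange_big mulr_sumr; apply: ler_sum => z _ /=.
rewrite -big_mkcond -big_filter big_const_seq count_predT iter_addr_0.
rewrite -[leLHS]mulr_natl ler_wpM2r ?sqmod_ge0 // ler_nat.
by apply: (colN z) => [|x]; rewrite ?filter_uniq // mem_filter => /andP[].
Qed.

End SparseMatrices.

Section UniformRoe.
Variables (R : realType) (X : eqType) (d : X -> X -> R).
Hypothesis dm : is_metric d.
Implicit Types (a b c : mat R X) (l : R[i]).

Lemma uroe_opnorm a : uroe d a -> exists2 M : R, 0 <= M & opnorm_le a M%:C.
Proof.
move=> [[M aM] _]; have M0 := opnorm_le_ge0 aM.
exists (complex.Re M); last by rewrite -ge0_complexE.
by rewrite -ler0c -ge0_complexE.
Qed.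

Lemma uroe_opsq a : uroe d a -> exists2 K, 0 <= K & opsq_le a K.
Proof.
move=> /uroe_opnorm[M M0 aM]; exists (M ^+ 2); first exact: sqr_ge0.
exact/opnorm_le_opsq.
Qed.

Lemma uroe_quasi_local a K : uroe d a -> 0 < K ->
  \forall r \near +oo, quasi_local d a K r.
Proof.
move=> [_ /(_ (Num.sqrt K))]; rewrite sqrtr_gt0 => approx K0.
have [b [[[r0 br0] _]]] := approx K0; rewrite -/(msub a b).
move/opsq_le_opnorm => /(_ (ltW K0)) abK.
near=> r => s t xi us ut st; apply: le_trans (abK s t xi us ut).
rewrite (eq_l2sq (g := mapply t (msub a b) xi)) // => x xs.
rewrite /mapply big_seq [RHS]big_seq; apply: eq_bigr => z zt; rewrite /msub.
suff -> : b x z = 0 by rewrite subr0.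
apply: contraTeq (st x z xs zt) => /br0 dxz; rewrite -leNgt.
by apply: le_trans dxz _; near: r; apply: nbhs_pinfty_ge; rewrite num_real.
Unshelve. all: by end_near.
Qed.

Lemma finite_propagation_add a b : finite_propagation d a ->
  finite_propagation d b -> finite_propagation d (madd a b).
Proof.
move=> [[r ar] [M aM]] [[r' br] [M' bM]]; split.
  exists (Num.max r r') => x z; rewrite le_max; apply: contraNT.
  rewrite negb_or => /andP[rx r'x]; rewrite /madd.
  have /eqP -> : a x z == 0 by apply: contraNT rx => /ar.
  have /eqP -> : b x z == 0 by apply: contraNT r'x => /br.
  by rewrite addr0.
exists (M + M') => x z; rewrite rmorphD.
exact: le_trans (ler_normD _ _) (lerD (aM x z) (bM x z)).
Qed.

Lemma finite_propagation_scale l a : finite_propagation d a ->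
  finite_propagation d (mscale l a).
Proof.
move=> [[r ar] [M aM]]; split.
  by exists r => x z; rewrite mulf_eq0 negb_or => /andP[_ /ar].
exists (complex.Re `|l| * M) => x z.
rewrite normrM rmorphM [X in X * _]ge0_complexE //.
by rewrite ler_wpM2l // -ge0_complexE.
Qed.

Lemma finite_propagation_adj a : finite_propagation d a ->
  finite_propagation d (madj a).
Proof.
move=> [[r ar] [M aM]]; split; last by exists M => x z; rewrite normcJ.
by exists r => x z; rewrite conjc_eq0 (is_metric_sym dm) => /ar.
Qed.

Lemma finite_propagation_mul a b c (A B : R) :
  opnorm_le a A%:C -> opnorm_le b B%:C -> mmul_rel a b c ->
  finite_propagation d a -> finite_propagation d b -> finite_propagation d c.
Proof.
move=> aA bB abc [[r ar] _] [[r' br] _]; split.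
  exists (r + r') => x z; apply: contraNT; rewrite -ltNge => dxz.
  have ab0 y : a x y * b y z = 0.
    apply/eqP; apply: contraTT dxz; rewrite mulf_eq0 negb_or -leNgt.
    by move=> /andP[/ar ? /br ?]; have := is_metric_triangle dm x y z; lra.
  apply/eqP; rewrite -(ab0 x); have /mmul_relP := abc.
  move/(_ x z)/net_sum_unique; apply.
  by apply: net_sum_single => y _; rewrite ab0.
have cAB := opnorm_leM aA bB abc.
have AB0 := opnorm_le_real_ge0 cAB.
exists (A * B) => x z; rewrite normc_le_sqmod //.
by apply: opsq_entry; apply/opnorm_le_opsq.
Qed.

Lemma uroe_add a b : uroe d a -> uroe d b -> uroe d (madd a b).
Proof.
move=> [[M aM] a_approx] [[N bN] b_approx]; split.
  by exists (M + N); apply: opnorm_leD.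
move=> e e0; have e2 : 0 < e / 2 by lra.
have [a' [fa' aa']] := a_approx _ e2; have [b' [fb' bb']] := b_approx _ e2.
exists (madd a' b'); split; first exact: finite_propagation_add.
have := opnorm_leD aa' bb'; rewrite -rmorphD -splitr.
by congr opnorm_le; apply/funext => x; apply/funext => z; rewrite /madd; ring.
Qed.

Lemma uroe_scale l a : uroe d a -> uroe d (mscale l a).
Proof.
move=> [[M aM] approx]; split; first by exists (`|l| * M); apply: opnorm_leZ.
move=> e e0; pose L := complex.Re `|l|.
have L0 : 0 <= L by rewrite -ler0c -ge0_complexE.
have [a' [fa' aa']] := approx (e / (L + 1)) ltac:(rewrite divr_gt0 //; lra).
exists (mscale l a'); split; first exact: finite_propagation_scale.
apply: opnorm_leW (_ : `|l| * (e / (L + 1))%:C <= _) _.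
  rewrite [X in X * _]ge0_complexE // -rmorphM lecR mulrA ler_pdivrMr; nra.
have := opnorm_leZ l aa'.
by congr opnorm_le; apply/funext => x; apply/funext => z; rewrite /mscale; ring.
Qed.

Lemma uroe_adj a : uroe d a -> uroe d (madj a).
Proof.
move=> [[M aM] approx]; split; first by exists M; apply: opnorm_le_adj.
move=> e /approx[a' [fa' /opnorm_le_adj aa']].
exists (madj a'); split; first exact: finite_propagation_adj.
move: aa'; congr opnorm_le.
by apply/funext => x; apply/funext => z; rewrite /madj rmorphB.
Qed.

(* [ab - a'b' = a (b - b') + (a - a') b']. *)
Lemma uroe_mul a b c : uroe d a -> uroe d b -> mmul_rel a b c -> uroe d c.
Proof.
move=> ua ub abc.
have [A A0 aA] := uroe_opnorm ua; have [B B0 bB] := uroe_opnorm ub.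
split; first by exists (A * B)%:C; apply: opnorm_leM abc.
move=> e e0; pose h := Num.min 1 (e / (A + B + 1)).
have h0 : 0 < h by rewrite lt_min ltr01 divr_gt0 //; lra.
have h1 : h <= 1 by rewrite ge_min lexx.
have he : h * (A + B + 1) <= e.
  by rewrite -ler_pdivlMr; [rewrite ge_min lexx orbT | lra].
have [b' [fb' bb']] := ub.2 _ h0; have [a' [fa' aa']] := ua.2 _ h0.
have approx_norm (m m' : mat R X) (M : R) : opnorm_le m M%:C ->
    opnorm_le (msub m m') h%:C -> opnorm_le m' (M + h)%:C.
  move=> mM mm'; have := opnorm_leB mM mm'; rewrite -rmorphD.
  by congr opnorm_le; apply/funext => x; apply/funext => z; rewrite /msub; ring.
have a'A := approx_norm _ _ _ aA aa'; have b'B := approx_norm _ _ _ bB bb'.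
have [c1 abc1] := mmul_exists aA b'B; have [c2 abc2] := mmul_exists a'A b'B.
exists c2; split; first exact: finite_propagation_mul a'A b'B abc2 fa' fb'.
have := opnorm_leD (opnorm_leM aA bb' (mmulBr abc abc1))
  (opnorm_leM aa' b'B (mmulBl abc1 abc2)).
rewrite -rmorphD => cc2.
have le_e : A * h + h * (B + h) <= e.
  by apply: le_trans he; have := ler_wpM2l (ltW h0) h1; lra.
apply: opnorm_leW (_ : (A * h + h * (B + h))%:C <= _) _; first by rewrite lecR.
move: cc2; congr opnorm_le.
by apply/funext => x; apply/funext => z; rewrite /madd /msub; ring.
Qed.

Lemma uroe_mul_exists a b : uroe d a -> uroe d b ->
  exists2 c, uroe d c & mmul_rel a b c.
Proof.
move=> ua ub; have [A _ aA] := uroe_opnorm ua; have [B _ bB] := uroe_opnorm ub.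
by have [c abc] := mmul_exists aA bB; exists c => //; apply: uroe_mul abc.
Qed.

Hypothesis du : ulf d.

Lemma finite_propagation_uroe b : finite_propagation d b -> uroe d b.
Proof.
move=> fb; split; last first.
  move=> e e0; exists b; split=> //.
  apply/opnorm_le_opsq; first exact: (ltW e0).
  move=> s t xi us ut; rewrite l2sq_zero.
    by rewrite !mulr_ge0 ?l2sq_ge0 ?(ltW e0).
  by move=> x _; rewrite /mapply big1 // => z _; rewrite subrr mul0r.
have [[r br] [M bM]] := fb.
have [|N ballN] := @du (Num.max r 1); first by rewrite lt_max ltr01 orbT.
have b_ball x z : b x z != 0 -> d x z <= Num.max r 1.
  by move=> /br dxz; rewrite le_max dxz.
exists (Num.sqrt (N%:R * M ^+ 2 * N%:R))%:C.
apply/opsq_le_opnorm; first by rewrite mulr_ge0 // mulr_ge0 // sqr_ge0.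
apply: sparse_opsq_le => [|x z|x s us bs|z s us bs]; first exact: sqr_ge0.
- have M0 : 0 <= M by rewrite -ler0c; apply: le_trans (bM x z).
  by rewrite -normc_le_sqmod.
- by apply: (ballN x) => // z /bs/b_ball.
- by apply: (ballN z) => // x /bs/b_ball; rewrite (is_metric_sym dm).
Qed.

Definition munit (y y' : X) : mat R X := fun u w => ((u == y) && (w == y'))%:R.

Definition mproj (S : X -> bool) : mat R X := fun u w => ((u == w) && S u)%:R.

Definition mband (r : R) : mat R X := fun u w => (d u w <= r)%R%:R.

Lemma uroe_indicator (P : rel X) r : (forall x z, P x z -> d x z <= r) ->
  uroe d (fun x z => (P x z)%:R).
Proof.
move=> Pr; apply: finite_propagation_uroe; split.
  by exists r => x z; case: (P x z) (Pr x z) => [+ _|_]; [exact | rewrite eqxx].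
by exists 1 => x z; case: (P x z); rewrite ?normr1 ?normr0 ?ler01.
Qed.

Lemma uroe_munit y y' : uroe d (munit y y').
Proof.
by apply: (@uroe_indicator _ (d y y')) => x z /andP[/eqP -> /eqP ->].
Qed.

Lemma uroe_mproj S : uroe d (mproj S).
Proof.
apply: (@uroe_indicator _ 0) => x z /andP[/eqP -> _].
by rewrite (is_metric_refl dm).
Qed.

Lemma uroe_mband r : uroe d (mband r).
Proof. exact: (@uroe_indicator _ r). Qed.

End UniformRoe.
Arguments munit {R X}.
Arguments mproj {R X}.

Section MatrixUnits.
Variables (R : realType) (X : eqType).
Implicit Types (a : mat R X) (S : X -> bool).

Lemma mmul_munitl y y' a :
  mmul_rel (munit y y') a (fun u w => (u == y)%:R * a y' w).
Proof.
apply/mmul_relP => u w.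
have -> : (u == y)%:R * a y' w = munit y y' u y' * a y' w.
  by rewrite /munit eqxx andbT.
apply: (net_sum_single (f := fun v => munit y y' u v * a v w)) => v vy.
by rewrite /munit (negbTE vy) andbF mul0r.
Qed.

Lemma mmul_munitr y y' a :
  mmul_rel a (munit y y') (fun u w => a u y * (w == y')%:R).
Proof.
apply/mmul_relP => u w.
have -> : a u y * (w == y')%:R = a u y * munit y y' y w.
  by rewrite /munit eqxx.
apply: (net_sum_single (f := fun v => a u v * munit y y' v w)) => v vy.
by rewrite /munit (negbTE vy) mulr0.
Qed.

Lemma mmul_munit_corner y y' z z' a :
  exists2 row, mmul_rel (munit y y') a row
    & mmul_rel row (munit z z') (mscale (a y' z) (munit y z')).
Proof.
have rowE := mmul_munitl y y' a; set row := (X in mmul_rel _ _ X) in rowE.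
exists row => //; have := mmul_munitr z z' row; congr mmul_rel.
apply/funext => u; apply/funext => w.
by rewrite /row /mscale /munit -mulnb natrM; ring.
Qed.

Lemma mmul_munit y y' z z' :
  mmul_rel (munit y y') (munit z z')
    (mscale (y' == z)%:R (munit y z') : mat R X).
Proof.
have := @mmul_munitl y y' (munit z z'); congr mmul_rel.
apply/funext => u; apply/funext => w; rewrite /mscale /munit -!natrM !mulnb.
by rewrite andbCA.
Qed.

Lemma mmul_mproj S : mmul_rel (mproj S) (mproj S) (mproj S : mat R X).
Proof.
apply/mmul_relP => u w.
have -> : mproj S u w = mproj S u u * mproj S u w :> R[i].
  by rewrite /mproj -natrM mulnb eqxx /=; case: (S u); rewrite ?andbF.
apply: (net_sum_single (f := fun v => mproj S u v * mproj S v w)) => v vu.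
by rewrite /mproj eq_sym (negbTE vu) mul0r.
Qed.

Lemma madj_munit y y' : madj (munit y y') = munit y' y :> mat R X.
Proof.
by apply/funext => u; apply/funext => w; rewrite /madj /munit conjc_nat andbC.
Qed.

Lemma madj_mproj S : madj (mproj S) = mproj S :> mat R X.
Proof.
apply/funext => u; apply/funext => w; rewrite /madj /mproj conjc_nat eq_sym.
by case: eqP => // ->.
Qed.

Lemma projection_mproj S : projection (mproj S : mat R X).
Proof. by split; [apply: madj_mproj | apply: mmul_mproj]. Qed.

Lemma munit_diag y : munit y y = mproj (pred1 y) :> mat R X.
Proof.
apply/funext => u; apply/funext => w; rewrite /munit /mproj /=.
by case: (eqVneq u y) => [->|_]; rewrite ?andbF // andbT eq_sym.
Qed.

Lemma mprojU S S' : (forall x, ~~ (S x && S' x)) ->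
  mproj (fun x => S x || S' x) = madd (mproj S) (mproj S') :> mat R X.
Proof.
move=> disj; apply/funext => u; apply/funext => w; rewrite /madd /mproj /=.
by have := disj u; case: (u == w) (S u) (S' u) => [] [] [] //=;
  rewrite ?addr0 ?add0r.
Qed.

End MatrixUnits.

(** * Isomorphisms are spatial *)

Section StarHomomorphisms.
Variable R : realType.
Local Notation C := R[i].

Record star_hom (X Y : eqType) (dX : X -> X -> R) (dY : Y -> Y -> R)
    (phi : mat R X -> mat R Y) : Prop := StarHom {
  star_hom_uroe : forall a, uroe dX a -> uroe dY (phi a);
  star_homD : forall a b, uroe dX a -> uroe dX b ->
    phi (madd a b) = madd (phi a) (phi b);
  star_homZ : forall l a, uroe dX a -> phi (mscale l a) = mscale l (phi a);
  star_hom_adj : forall a, uroe dX a -> phi (madj a) = madj (phi a);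
  star_homM : forall a b c, uroe dX a -> uroe dX b -> uroe dX c ->
    mmul_rel a b c -> mmul_rel (phi a) (phi b) (phi c) }.

Definition iso_pair (X Y : eqType) (dX : X -> X -> R) (dY : Y -> Y -> R)
    (phi : mat R X -> mat R Y) (psi : mat R Y -> mat R X) : Prop :=
  [/\ star_hom dX dY phi, star_hom dY dX psi,
    forall a, uroe dX a -> psi (phi a) = a
    & forall c, uroe dY c -> phi (psi c) = c].

(* [psi] is the conjugation [c |-> sum_(y, y') c y y' v_y v_y'^*], where [v_y]
   is the row [V y]; only its values on the matrix units are recorded. *)
Definition implements (X Y : eqType) (psi : mat R Y -> mat R X)
    (V : Y -> X -> C) : Prop :=
  forall y y' a b, psi (munit y y') a b = V y a * conjc (V y' b).

Definition spatial_iso (X Y : eqType) (dX : X -> X -> R) (dY : Y -> Y -> R)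
    (phi : mat R X -> mat R Y) (psi : mat R Y -> mat R X)
    (V : Y -> X -> C) : Prop :=
  [/\ iso_pair dX dY phi psi, implements psi V
    & implements phi (fun x y => conjc (V y x))].

Lemma spatial_iso_sym (X Y : eqType) (dX : X -> X -> R) (dY : Y -> Y -> R)
    phi psi V : spatial_iso dX dY phi psi V ->
  spatial_iso dY dX psi phi (fun x y => conjc (V y x)).
Proof.
move=> [[hphi hpsi phiK psiK] psiV phiV]; split=> // y y' a b.
by rewrite !conjcK psiV.
Qed.

Lemma star_iso_hom (X Y : eqType) (dX : X -> X -> R) (dY : Y -> Y -> R) phi :
  star_iso dX dY phi -> star_hom dX dY phi.
Proof. by move=> [? [_ [_ [? [? [? ?]]]]]]; split. Qed.

Lemma star_iso_inverse (X Y : eqType) (dX : X -> X -> R) (dY : Y -> Y -> R)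
    phi : is_metric dX -> is_metric dY -> star_iso dX dY phi ->
  exists psi, iso_pair dX dY phi psi.
Proof.
move=> mX mY iso; have hphi := star_iso_hom iso.
have [phiU [phi_inj [phi_surj _]]] := iso.
have preimage c : exists a, uroe dY c -> uroe dX a /\ phi a = c.
  have [uc|nc] := pselect (uroe dY c); last by exists (fun _ _ => 0).
  by have [a ua ac] := phi_surj c uc; exists a.
have [psi psiP] := choice preimage.
have psiU c : uroe dY c -> uroe dX (psi c) by move=> /psiP[].
have psiK c : uroe dY c -> phi (psi c) = c by move=> /psiP[].
have phiK a : uroe dX a -> psi (phi a) = a.
  move=> ua; apply: phi_inj; rewrite ?psiK //; last exact: phiU.
  by apply/psiU/phiU.
exists psi; split=> //; split=> // [a b ua ub|l a ua|a ua|a b c ua ub uc abc].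
- have uab : uroe dX (madd (psi a) (psi b)) by apply: uroe_add; apply: psiU.
  by rewrite -(phiK _ uab) (star_homD hphi) ?psiK //; apply: psiU.
- have ula : uroe dX (mscale l (psi a)) by apply/uroe_scale/psiU.
  by rewrite -(phiK _ ula) (star_homZ hphi) ?psiK //; apply: psiU.
- have uadj : uroe dX (madj (psi a)) by apply/uroe_adj/psiU.
  by rewrite -(phiK _ uadj) (star_hom_adj hphi) ?psiK //; apply: psiU.
- have [e ue abe] := uroe_mul_exists mX (psiU a ua) (psiU b ub).
  have := star_homM hphi (psiU a ua) (psiU b ub) ue abe.
  by rewrite !psiK // => /(mmul_unique abc) ->; rewrite phiK.
Qed.

Lemma star_hom_projection (X Y : eqType) (dX : X -> X -> R)
    (dY : Y -> Y -> R) phi p : star_hom dX dY phi ->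
  uroe dX p -> projection p -> projection (phi p).
Proof.
move=> hphi up [p_adj pp]; split; last exact: (star_homM hphi) pp.
by rewrite -(star_hom_adj hphi) // p_adj.
Qed.

Lemma mmul_munit_entry (X : eqType) (a b c m : mat R X) u v x z :
  mmul_rel a (munit u v) c -> mmul_rel c b m -> m x z = a x u * b v z.
Proof.
move=> /(mmul_unique (@mmul_munitr R X u v a)) <- /mmul_relP/(_ x z).
move/net_sum_unique; apply.
have -> : a x u * b v z = a x u * (v == v)%:R * b v z by rewrite eqxx mulr1.
apply: (net_sum_single (f := fun w => a x u * (w == v)%:R * b w z)) => w wv.
by rewrite (negbTE wv) mulr0 mul0r.
Qed.

Section IsoPair.
Variables (X Y : eqType) (dX : X -> X -> R) (dY : Y -> Y -> R).
Variables (phi : mat R X -> mat R Y) (psi : mat R Y -> mat R X).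
Hypotheses (mX : is_metric dX) (mY : is_metric dY) (uX : ulf dX) (uY : ulf dY).
Hypothesis iso : iso_pair dX dY phi psi.

(* Minimality of the projections [munit y y]: compressing [m = phi (munit a b)]
   gives [munit y y' m munit z z' = m y' z munit y z'], to which [psi] is
   applied. *)
Lemma iso_pair_compress y y' z z' a b u w :
  psi (munit y y') u a * psi (munit z z') b w =
  phi (munit a b) y' z * psi (munit y z') u w.
Proof.
have [hphi hpsi phiK _] := iso; set m := phi (munit a b).
have uab : uroe dX (munit a b) by apply: uroe_munit.
have um : uroe dY m by apply: star_hom_uroe uab.
have ue v v' : uroe dY (munit v v') by apply: uroe_munit.
have [row rowE cornerE] := mmul_munit_corner y y' z z' m.
have urow : uroe dY row by apply: uroe_mul rowE.
have rowM := star_homM hpsi (ue _ _) um urow rowE; rewrite phiK // in rowM.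
have cornerM := star_homM hpsi urow (ue _ _) (uroe_scale _ (ue _ _)) cornerE.
by rewrite -(mmul_munit_entry u w rowM cornerM) (star_homZ hpsi).
Qed.

Lemma psi_munit_diag_neq0 y : exists o, psi (munit y y) o o != 0.
Proof.
have [_ hpsi _ psiK] := iso; have ue := uroe_munit mY uY y y.
apply/not_existsP => diag0.
have psi0 a b : psi (munit y y) a b = 0.
  have := iso_pair_compress y y y y a a b b.
  have /negP/negPn/eqP -> := diag0 b; rewrite mulr0.
  rewrite -{1}(madj_munit R y y) (star_hom_adj hpsi) // /madj mulrC mulc_conj.
  by move/complexI/eqP; rewrite sqmod_eq0 => /eqP.
have : phi (psi (munit y y)) = phi (psi (mscale 0 (munit y y))).
  congr phi; rewrite (star_homZ hpsi) //; apply/funext => a; apply/funext => b.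
  by rewrite /mscale psi0 mulr0.
rewrite !psiK //; last exact: uroe_scale.
move/(congr1 (fun m => m y y)); rewrite /mscale mul0r /munit eqxx => /eqP.
by rewrite oner_eq0.
Qed.

Lemma psi_munit_conj y y' a b :
  conjc (psi (munit y y') a b) = psi (munit y' y) b a.
Proof.
have [_ hpsi _ _] := iso.
by rewrite -(madj_munit R y y') (star_hom_adj hpsi) //; apply: uroe_munit.
Qed.

Lemma psi_munit_diag_gt0 y o : psi (munit y y) o o != 0 ->
  exists2 r : R, 0 < r & psi (munit y y) o o = r%:C.
Proof.
have [_ hpsi _ _] := iso.
have proj : projection (psi (munit y y)).
  apply: (star_hom_projection hpsi); first exact: uroe_munit.
  by rewrite munit_diag; apply: projection_mproj.
rewrite (projection_diag_real _ proj) => re_neq0.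
exists (complex.Re (psi (munit y y) o o)) => //.
rewrite lt_neqAle projection_diag_ge0 // andbT eq_sym.
by apply: contraNneq re_neq0 => ->.
Qed.

(* With [psi (munit y0 y0) o o != 0], take for [V y] the normalized column at
   [o] of [psi (munit y y0)]. *)
Lemma iso_pair_implemented : exists V : Y -> X -> C,
  implements psi V /\ implements phi (fun x y => conjc (V y x)).
Proof.
have [[y0 _]|noY] := pselect (exists y : Y, True); last first.
  exists (fun _ _ => 0).
  by split=> [y|a b y]; case: noY; exists y.
have [o oo] := psi_munit_diag_neq0 y0.
have [r r0 rE] := psi_munit_diag_gt0 oo.
have w_sqr : ((Num.sqrt r)^-1)%:C * ((Num.sqrt r)^-1)%:C * r%:C = 1.
  rewrite -!rmorphM -expr2 exprVn sqr_sqrtr ?(ltW r0) //= mulVf //.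
  exact: lt0r_neq0.
set w := (_^-1)%:C in w_sqr.
pose V y a := w * psi (munit y y0) a o.
have V_conj y b : conjc (V y b) = w * psi (munit y0 y) o b.
  rewrite -psi_munit_conj rmorphM; congr (_ * _).
  by rewrite /= oppr0.
have phi_diag : phi (munit o o) y0 y0 = r%:C.
  have := iso_pair_compress y0 y0 y0 y0 o o o o; rewrite rE.
  by move/mulIf => -> //; rewrite -rE.
exists V; split=> [y y' a b|a b y y'].
  rewrite V_conj mulrACA iso_pair_compress phi_diag mulrA.
  by rewrite w_sqr mul1r.
have := iso_pair_compress y0 y y' y0 a b o o.
rewrite conjcK V_conj rE => compressE.
have r_neq0 : r%:C != 0 :> C by rewrite -rE.
apply: (mulIf r_neq0); rewrite -compressE /V.
by rewrite mulrACA [RHS]mulrAC w_sqr mul1r.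
Qed.

End IsoPair.

Lemma uroe_isomorphic_spatial (X Y : eqType) (dX : X -> X -> R)
    (dY : Y -> Y -> R) : is_metric dX -> is_metric dY -> ulf dX -> ulf dY ->
  uroe_isomorphic dX dY -> exists phi psi V, spatial_iso dX dY phi psi V.
Proof.
move=> mX mY uX uY [phi iso].
have [psi pair] := star_iso_inverse mX mY iso.
have [V [psiV phiV]] := iso_pair_implemented mX mY uX uY pair.
by exists phi, psi, V.
Qed.

Lemma spatial_iso_rows_orthonormal (X Y : eqType) (dX : X -> X -> R)
    (dY : Y -> Y -> R) phi psi V : is_metric dX -> is_metric dY ->
  ulf dX -> ulf dY -> spatial_iso dX dY phi psi V ->
  forall y y', net_sum (fun a => conjc (V y a) * V y' a) (y == y')%:R.
Proof.
move=> mX mY uX uY [pair psiV _] y y'; have [_ hpsi _ _] := pair.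
have V_neq0 z : exists a, V z a != 0.
  have [o] := psi_munit_diag_neq0 mX mY uX uY pair z.
  by rewrite psiV mulf_eq0 negb_or => /andP[? _]; exists o.
have [a ya] := V_neq0 y; have [b y'b] := V_neq0 y'.
have ue z z' : uroe dY (munit z z') by apply: uroe_munit.
have := star_homM hpsi (ue y y) (ue y' y') (uroe_scale _ (ue _ _))
  (@mmul_munit R Y y y y' y').
rewrite (star_homZ hpsi) // => /mmul_relP/(_ a b).
have ab_neq0 : V y a * conjc (V y' b) != 0 by rewrite mulf_neq0 ?conjc_eq0.
move/(cvgcMr (V y a * conjc (V y' b))^-1); rewrite /mscale psiV mulfK //.
congr cvgc; apply/funext => F; rewrite mulr_suml; apply: eq_bigr => c _.
rewrite !psiV; apply: (mulIf ab_neq0); rewrite mulfVK //; ring.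
Qed.

Lemma spatial_iso_row_unit (X Y : eqType) (dX : X -> X -> R)
    (dY : Y -> Y -> R) phi psi V : is_metric dX -> is_metric dY ->
  ulf dX -> ulf dY -> spatial_iso dX dY phi psi V ->
  forall y, l2sq F (V y) @[F --> exhausting X] --> (1 : R).
Proof.
move=> mX mY uX uY iso y.
have [] := spatial_iso_rows_orthonormal mX mY uX uY iso y y.
rewrite eqxx /= => row_unit _.
have -> // : (fun F => l2sq F (V y)) =
    (fun F => complex.Re (\sum_(a <- F) conjc (V y a) * V y a)).
by apply/funext => F; rewrite -/(inner F (V y) (V y)) inner_self.
Qed.

End StarHomomorphisms.

(** * Hall's theorem for infinite families of finite sets *)

Section Hall.
Variables X Y : choiceType.
Local Open Scope nat_scope.
Local Open Scope fset_scope.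
Implicit Types (N M : X -> {fset Y}) (A : {fset X}) (x : X) (y : Y).

Definition image_fset N A : {fset Y} := \bigcup_(x <- A) N x.

Definition hall N : Prop := forall A, #|` A| <= #|` image_fset N A|.

Definition subfamily N M : Prop := forall x, N x `<=` M x.

Definition minimal_hall M : Prop :=
  hall M /\ forall N, hall N -> subfamily N M -> N = M.

Lemma mem_image_fset N A y :
  reflect (exists2 x, x \in A & y \in N x) (y \in image_fset N A).
Proof.
by apply: (iffP (bigfcupP _ _ _ _)) => -[x xA yN]; exists x;
  rewrite ?andbT in xA *.
Qed.

Lemma image_fset_mem N A x y : x \in A -> y \in N x -> y \in image_fset N A.
Proof. by move=> xA yx; apply/mem_image_fset; exists x. Qed.

Lemma eq_image_fset N M A : {in A, N =1 M} -> image_fset N A = image_fset M A.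
Proof.
by move=> NM; apply/fsetP => y; apply/mem_image_fset/mem_image_fset;
  move=> -[x xA yx]; exists x => //; rewrite ?NM // -?NM.
Qed.

Lemma subfamily_trans N M P : subfamily N M -> subfamily M P -> subfamily N P.
Proof. by move=> NM MP x; apply: fsubset_trans (NM x) (MP x). Qed.

Lemma subfamily_anti N M : subfamily N M -> subfamily M N -> N = M.
Proof.
by move=> NM MN; apply/funext => x; apply/eqP; rewrite eqEfsubset NM MN.
Qed.

(* The sets being finite, a chain of families is eventually constant on each
   finite [A]. *)
Lemma hall_chain (T : Type) (F : T -> X -> {fset Y}) (chain : T -> Prop) t0 :
  chain t0 -> (forall t, hall (F t)) ->
  (forall s t, chain s -> chain t ->
     subfamily (F s) (F t) \/ subfamily (F t) (F s)) ->
  exists2 N, hall N & forall t, chain t -> subfamily N (F t).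
Proof.
move=> ch0 hallF total.
have minimum x :
    exists t, chain t /\ forall s, chain s -> #|` F t x| <= #|` F s x|.
  pose P n := `[< exists2 t, chain t & #|` F t x| = n >].
  have exP : exists n, P n by exists #|` F t0 x|; apply/asboolP; exists t0.
  case: (ex_minnP exP) => n /asboolP[t ct <-] tmin.
  by exists t; split=> // s cs; apply: tmin; apply/asboolP; exists s.
have [m mP] := choice minimum.
pose N x := F (m x) x.
have N_le t : chain t -> subfamily N (F t).
  move=> ct x; have [cm mmin] := mP x.
  have [mt|tm] := total _ _ cm ct; first exact: mt.
  have /eqP : F t x == F (m x) x by rewrite eqEfcard tm mmin.
  by rewrite /N => ->.
exists N => // A.
suff [t ct tA] : exists2 t, chain t & {in (A : seq X), F t =1 N}.
  by rewrite -(eq_image_fset tA); apply: hallF.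
elim: (A : seq X) => [|x s [t ct IH]]; first by exists t0.
have [cm _] := mP x.
have [mt|tm] := total _ _ cm ct.
  exists (m x) => // z; rewrite inE => /orP[/eqP -> //|zs].
  by apply/eqP; rewrite eqEfsubset N_le // andbT -(IH z zs).
exists t => // z; rewrite inE => /orP[/eqP ->|/IH //].
by apply/eqP; rewrite eqEfsubset N_le // andbT.
Qed.

Lemma exists_minimal_hall N :
  hall N -> exists2 M, minimal_hall M & subfamily M N.
Proof.
move=> hallN; pose T := {M : X -> {fset Y} | hall M /\ subfamily M N}.
pose r (s t : T) := `[< subfamily (sval t) (sval s) >].
have t0 : T by exists N; split=> // x; apply: fsubset_refl.
have [||B total|t tmax] := @ZL_preorder T t0 r.
- by move=> t; apply/asboolP => x; apply: fsubset_refl.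
- move=> s t u /asboolP st /asboolP tu; apply/asboolP.
  exact: subfamily_trans tu st.
- have [[b Bb]|noB] := pselect (exists b, B b); last first.
    by exists t0 => s Bs; case: noB; exists s.
  have [|s u Bs Bu|M hallM M_le] := @hall_chain T (fun t => sval t) B b Bb.
  + by move=> s; case: (svalP s).
  + by have [/asboolP|/asboolP] := total s u Bs Bu; [right | left].
  have MN : hall M /\ subfamily M N.
    split=> //; apply: subfamily_trans (M_le b Bb) _.
    by case: (svalP b).
  by exists (exist _ M MN) => s Bs; apply/asboolP/M_le.
have [hall_t tN] := svalP t.
exists (sval t) => //; split=> // M hallM Mt.
have MN : hall M /\ subfamily M N by split=> //; apply: subfamily_trans tN.
have /asboolP tM := tmax (exist _ M MN) (introT (asboolP _) Mt).
exact: subfamily_anti.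
Qed.

Definition remove_point N x y : X -> {fset Y} :=
  fun z => if z == x then N z `\ y else N z.

Lemma remove_point_not_hall N x y : hall N -> ~ hall (remove_point N x y) ->
  exists2 A, x \notin A & #|` image_fset N A `|` (N x `\ y)| <= #|` A|.
Proof.
move=> hallN not_hall.
have [A A_gt] : exists A, #|` image_fset (remove_point N x y) A| < #|` A|.
  apply: contrapT => none; apply: not_hall => A; rewrite leqNgt.
  by apply/negP => A_gt; apply: none; exists A.
have xA : x \in A.
  apply: contraT => xA; have := hallN A; rewrite leqNgt => /negP; case.
  rewrite -(@eq_image_fset (remove_point N x y)) // => z zA.
  by rewrite /remove_point; case: eqP => // zx; rewrite -zx zA in xA.
exists (A `\ x); first by rewrite !inE eqxx.
have cardA := cardfsD1 x A; rewrite xA in cardA.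
suff: #|` image_fset N (A `\ x) `|` (N x `\ y)| <=
    #|` image_fset (remove_point N x y) A| by lia.
apply: fsubset_leq_card; apply/fsubsetP => u; rewrite in_fsetU => /orP[].
  case/mem_image_fset => z; rewrite in_fsetD1 => /andP[zx zA] uz.
  by apply: (image_fset_mem zA); rewrite /remove_point (negbTE zx).
by move=> ux; apply: (image_fset_mem xA); rewrite /remove_point eqxx.
Qed.

(* Rado: two removable points would contradict submodularity of cardinality. *)
Lemma minimal_hall_subsingleton M x y1 y2 :
  minimal_hall M -> y1 \in M x -> y2 \in M x -> y1 = y2.
Proof.
move=> [hallM Mmin] y1x y2x; apply/eqP; apply: contraT => y12.
have tight y : y \in M x ->
    exists2 A, x \notin A & #|` image_fset M A `|` (M x `\ y)| <= #|` A|.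
  move=> yx; apply: remove_point_not_hall => // /Mmin removeE.
  have /(congr1 (fun N => N x)) : remove_point M x y = M.
    apply: removeE => z; rewrite /remove_point; case: eqP => // _.
    exact: fsubsetDl.
  by rewrite /remove_point eqxx => /fsetP/(_ y); rewrite !inE eqxx yx.
have [A1 xA1 card1] := tight _ y1x; have [A2 xA2 card2] := tight _ y2x.
set B1 := _ `|` _ in card1; set B2 := _ `|` _ in card2.
have cardU : #|` x |` (A1 `|` A2)| <= #|` B1 `|` B2|.
  apply: leq_trans (hallM _) _; apply: fsubset_leq_card; apply/fsubsetP => y.
  case/mem_image_fset => z; rewrite in_fset1U !in_fsetU !in_fsetD1.
  case/orP => [/eqP -> ->|/orP[zA|zA] /(image_fset_mem zA) ->];
    rewrite ?orbT // !andbT.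
  by have [->|] := eqVneq y y1; rewrite ?y12 !orbT.
have cardI : #|` A1 `&` A2| <= #|` B1 `&` B2|.
  apply: leq_trans (hallM _) _; apply: fsubset_leq_card; apply/fsubsetP => y.
  case/mem_image_fset => z; rewrite in_fsetI => /andP[z1 z2] yz.
  by rewrite in_fsetI !in_fsetU (image_fset_mem z1 yz) (image_fset_mem z2 yz).
have := cardfsUI A1 A2; have := cardfsUI B1 B2.
have := cardfsU1 x (A1 `|` A2); rewrite in_fsetU (negbTE xA1) (negbTE xA2) /=.
lia.
Qed.

Lemma hall_matching N : hall N -> exists h : X -> Y,
  injective h /\ forall x, h x \in N x.
Proof.
move=> /exists_minimal_hall[M Mmin MN]; have [hallM _] := Mmin.
have M_neq0 x : exists y, y \in M x.
  have := hallM [fset x]; rewrite cardfs1 cardfs_gt0 => /fset0Pn[y].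
  by case/mem_image_fset => z; rewrite inE => /eqP ->; exists y.
have [h hM] := choice M_neq0.
exists h; split=> [x x' hx|x]; last exact: (fsubsetP (MN x)).
apply/eqP; apply: contraT => xx'.
have := hallM [fset x; x']; rewrite cardfs2 xx'.
suff: #|` image_fset M [fset x; x']| <= 1 by lia.
rewrite -(cardfs1 (h x)); apply: fsubset_leq_card; apply/fsubsetP => y.
case/mem_image_fset => z; rewrite !inE => /orP[/eqP ->|/eqP ->] yz.
  by rewrite (minimal_hall_subsingleton Mmin yz (hM x)).
by rewrite hx (minimal_hall_subsingleton Mmin yz (hM x')).
Qed.

End Hall.

Lemma cantor_bernstein_rel (X Y : Type) (r : X -> Y -> Prop) (h : X -> Y)
    (k : Y -> X) : injective h -> injective k ->
  (forall x, r x (h x)) -> (forall y, r (k y) y) ->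
  exists2 f : X -> Y, bijective f & forall x, r x (f x).
Proof.
move=> h_inj k_inj rh rk.
pose orb x := exists n z, (forall y, k y <> z) /\ x = iter n (k \o h) z.
have piecewise x : exists y, (orb x -> y = h x) /\ (~ orb x -> k y = x).
  have [xo|xo] := pselect (orb x); first by exists (h x).
  have [y yx] : exists y, k y = x.
    apply: contrapT => none; apply: xo; exists 0%N, x; split=> // y yx.
    by apply: none; exists y.
  by exists y.
have [f fP] := choice piecewise.
have f_orb x : orb x -> f x = h x by case: (fP x).
have f_norb x : ~ orb x -> k (f x) = x by case: (fP x).
have orbS x : orb x -> orb (k (h x)).
  by move=> [n [z [zk ->]]]; exists n.+1, z.
have f_inj : injective f.
  move=> x x'.
  have [xo|xo] := pselect (orb x); have [xo'|xo'] := pselect (orb x').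
  - by rewrite !f_orb //; apply: h_inj.
  - rewrite f_orb // => e; case: (xo').
    by rewrite -(f_norb _ xo') -e; apply: orbS.
  - rewrite [f x']f_orb // => e; case: (xo).
    by rewrite -(f_norb _ xo) e; apply: orbS.
  - by move=> e; rewrite -(f_norb _ xo) -(f_norb _ xo') e.
have f_surj y : exists x, f x = y.
  have [[[|n] [z [zk e]]]|yo] := pselect (orb (k y)).
  - by case: (zk y).
  - exists (iter n (k \o h) z); rewrite f_orb; last by exists n, z.
    by apply: k_inj; rewrite e.
  by exists (k y); apply: k_inj; rewrite f_norb.
have [g gP] := choice f_surj.
exists f; first by exists g => // x; apply: f_inj; rewrite gP.
move=> x; have [xo|xo] := pselect (orb x); first by rewrite f_orb.
by rewrite -{1}(f_norb _ xo); apply: rk.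
Qed.

(** * Coarse geometry *)

Section LocallyFiniteMetrics.
Variables (R : realType) (X : eqType) (d : X -> X -> R).
Hypothesis du : ulf d.

Lemma ulf_ball (r : R) : 0 < r -> exists N : nat, forall x, exists s : seq X,
  [/\ uniq s, (size s <= N)%N & forall y, (y \in s) = (d x y <= r)].
Proof.
move=> r0; have [N ballN] := du r0; exists N => x.
pose P n := `[< exists s : seq X,
  [/\ uniq s, forall y, y \in s -> d x y <= r & size s = n] >].
have P0 : exists n, P n by exists 0%N; apply/asboolP; exists [::].
have PN n : P n -> (n <= N)%N.
  by move=> /asboolP[s [us sr <-]]; apply: ballN us sr.
case: (ex_maxnP P0 PN) => n /asboolP[s [us sr sn]] nmax.
exists s; split=> [||y]; [by []|exact: ballN us sr|].
apply/idP/idP => [/sr //|dy]; apply: contraT => ys.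
suff /nmax : P n.+1 by rewrite ltnn.
apply/asboolP; exists (y :: s); rewrite /= ys us sn; split=> // z.
by rewrite inE => /orP[/eqP ->//|/sr].
Qed.

Lemma ulf_neighborhood (r : R) (A : seq X) : 0 < r ->
  exists2 B : seq X, uniq B
    & forall y, (y \in B) = has (fun x => d x y <= r) A.
Proof.
move=> /ulf_ball[N ballN]; have [ball ballP] := choice ballN.
exists (undup (flatten (map ball A))) => [|y]; first exact: undup_uniq.
rewrite mem_undup; apply/flatten_mapP/hasP => -[x xA yx]; exists x => //.
  by have [_ _ <-] := ballP x.
by have [_ _ ->] := ballP x.
Qed.

End LocallyFiniteMetrics.

Lemma underdetermined_system (K : fieldType) (X Y : eqType) (A : seq X)
    (G : seq Y) (f : Y -> X -> K) : uniq A -> (size G < size A)%N ->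
  exists2 xi : X -> K, exists2 x, x \in A & xi x != 0
    & forall y, y \in G -> \sum_(x <- A) f y x * xi x = 0.
Proof.
move=> uA sGA.
pose M := \matrix_(i < size A, j < size G)
  f (tnth (in_tuple G) j) (tnth (in_tuple A) i).
have : kermx M != 0.
  rewrite -mxrank_eq0 mxrank_ker -lt0n subn_gt0.
  exact: leq_ltn_trans (rank_leq_col M) sGA.
case/rowV0Pn => v /sub_kermxP vM v0.
pose xi x := if insub (index x A) is Some i then v 0 i else 0.
have xiE (i : 'I_(size A)) : xi (tnth (in_tuple A) i) = v 0 i.
  rewrite /xi (tnth_nth (tnth (in_tuple A) i)) /= index_uniq //.
  by rewrite valK.
exists xi.
  have [i vi] := rV0Pn _ v0.
  by exists (tnth (in_tuple A) i); [exact: mem_tnth | rewrite xiE].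
move=> y yG; have /tnthP[j ->] : y \in in_tuple G by [].
have := congr1 (fun m : 'rV__ => m 0 j) vM; rewrite !mxE => vM_j.
by rewrite -[RHS]vM_j big_tnth; apply: eq_bigr => i _; rewrite xiE mxE mulrC.
Qed.

Section CoarseGeometry.
Variable R : realType.

Lemma close_bound (X Y : Type) (dY : Y -> Y -> R) (f g : X -> Y) :
  close dY f g -> exists2 M, 0 < M & forall x, dY (f x) (g x) <= M.
Proof.
move=> [M fgM]; exists (Num.max M 1) => [|x].
  by rewrite lt_max ltr01 orbT.
by rewrite le_max fgM.
Qed.

Lemma close_sym (X Y : Type) (dY : Y -> Y -> R) (f g : X -> Y) :
  is_metric dY -> close dY f g -> close dY g f.
Proof. by move=> mY [M fgM]; exists M => x; rewrite (is_metric_sym mY). Qed.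

Lemma close_trans (X Y : Type) (dY : Y -> Y -> R) (g f h : X -> Y) :
  is_metric dY -> close dY f g -> close dY g h -> close dY f h.
Proof.
move=> mY [M fgM] [N ghN]; exists (M + N) => x.
exact: le_trans (is_metric_triangle mY _ (g x) _) (lerD (fgM x) (ghN x)).
Qed.

Lemma close_compl (X Y Z : Type) (dY : Y -> Y -> R) (dZ : Z -> Z -> R)
    (k : Y -> Z) (f g : X -> Y) :
  coarse dY dZ k -> close dY f g -> close dZ (k \o f) (k \o g).
Proof.
move=> kc /close_bound[M M0 fgM]; have [s [_ ks]] := kc M M0.
by exists s => x; apply: ks.
Qed.

Lemma close_compr (X Y Z : Type) (dZ : Z -> Z -> R) (f g : Y -> Z)
    (k : X -> Y) : close dZ f g -> close dZ (f \o k) (g \o k).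
Proof. by move=> [M fgM]; exists M => x; apply: fgM. Qed.

Lemma coarse_close (X Y : Type) (dX : X -> X -> R) (dY : Y -> Y -> R)
    (f g : X -> Y) :
  is_metric dY -> coarse dX dY f -> close dY f g -> coarse dX dY g.
Proof.
move=> mY fc /close_bound[M M0 fgM] r /fc[s [s0 fs]]; exists (M + s + M).
split=> [|x x' /fs fxx']; first by rewrite !addr_gt0.
have := is_metric_triangle mY (g x) (f x) (g x').
have := is_metric_triangle mY (f x) (f x') (g x').
have := fgM x; have := fgM x'; rewrite (is_metric_sym mY (g x) (f x)); lra.
Qed.

Lemma coarse_equivalence_close (X Y : Type) (dX : X -> X -> R)
    (dY : Y -> Y -> R) (f g : X -> Y) : is_metric dX -> is_metric dY ->
  coarse_equivalence dX dY f -> close dY f g -> coarse_equivalence dX dY g.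
Proof.
move=> mX mY [fc [k [kc [fk kf]]]] fg; have gf := close_sym mY fg.
split; first exact: coarse_close fg.
exists k; split=> //; split; first exact: close_trans (close_compr k gf) fk.
exact: close_trans (close_compl kc gf) kf.
Qed.

Lemma bij_coarse_equiv_of_injections (X Y : Type) (dX : X -> X -> R)
    (dY : Y -> Y -> R) (f h : X -> Y) (g k : Y -> X) :
  is_metric dX -> is_metric dY -> coarse dX dY f -> coarse dY dX g ->
  close dY (f \o g) id -> close dX (g \o f) id ->
  injective h -> close dY f h -> injective k -> close dX g k ->
  bij_coarse_equiv dX dY.
Proof.
move=> mX mY fc gc fg gf h_inj [M fhM] k_inj gk.
have [N fkN] : close dY (f \o k) id.
  exact: close_trans (close_compl fc (close_sym mX gk)) fg.
have [||F F_bij fF] := @cantor_bernstein_rel _ _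
  (fun x y => dY (f x) y <= Num.max M N) h k h_inj k_inj.
- by move=> x; rewrite le_max fhM.
- by move=> y; rewrite le_max fkN orbT.
exists F; split=> //; apply: (@coarse_equivalence_close _ _ _ _ f) => //.
  by split=> //; exists g.
by exists (Num.max M N).
Qed.

Lemma hall_injection (X Y : choiceType) (dX : X -> X -> R) (dY : Y -> Y -> R)
    (f : X -> Y) (g : Y -> X) :
  is_metric dY -> ulf dY -> coarse dX dY f -> close dY (f \o g) id ->
  (exists M, forall (A : seq X) (G : seq Y), uniq A ->
     (forall y x, x \in A -> dX x (g y) <= M -> y \in G) ->
     (size A <= size G)%N) ->
  exists2 h : X -> Y, injective h & close dY f h.
Proof.
move=> mY uY fc /close_bound[L L0 fgL] [M hallM].
have [|s [s0 fs]] := fc (Num.max M 1); first by rewrite lt_max ltr01 orbT.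
have near x y : dX x (g y) <= M -> dY (f x) y <= s + L.
  move=> xgy; apply: le_trans (is_metric_triangle mY _ (f (g y)) _) _.
  by apply: lerD (fgL y); apply: fs; rewrite le_max xgy.
have [N ballN] := ulf_ball uY (addr_gt0 s0 L0).
have candidates x :
    exists B : {fset Y}, forall y, (y \in B) = (dX x (g y) <= M).
  have [b [_ _ bE]] := ballN (f x).
  exists (seq_fset tt [seq y <- b | dX x (g y) <= M]) => y.
  by rewrite seq_fsetE mem_filter bE andb_idr // => /near.
have [B BE] := choice candidates.
have [|h [h_inj hB]] := @hall_matching _ _ B.
  move=> A; apply: hallM => [|y x xA xgy]; first exact: fset_uniq.
  by apply: image_fset_mem xA _; rewrite BE.
by exists h => //; exists (s + L) => x; apply: near; rewrite -BE.
Qed.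

End CoarseGeometry.

(** * Quasi-locality and concentration *)

Section CantorSpaceOfSubsets.
Variable Y : eqType.
Implicit Types (S T : Y -> bool) (G : seq Y).

(* The neighbourhoods of [S] in the product topology on subsets of [Y]. *)
Definition trace_nbhs S : set_system (Y -> bool) :=
  [set P | exists G, forall T, {in G, S =1 T} -> P T].

Global Instance trace_nbhs_filter S : ProperFilter (trace_nbhs S).
Proof.
split; first by move=> [G /(_ S)]; apply.
split=> [|P Q [G PG] [G' QG]|P Q PQ [G PG]].
- by exists [::].
- exists (G ++ G') => T ST.
  by split; [apply: PG | apply: QG] => y yG; apply: ST;
    rewrite mem_cat yG ?orbT.
- by exists G => T ST; apply/PQ/PG.
Qed.

Lemma subsets_baire (Q : nat -> set (Y -> bool)) :
  (forall n S, ~ Q n S -> \forall T \near trace_nbhs S, ~ Q n T) ->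
  (forall S, exists n, Q n S) ->
  exists n S, \forall T \near trace_nbhs S, Q n T.
Proof.
move=> Qclosed Qcover; apply: contrapT => nQ.
have shrink (p : nat * (seq Y * (Y -> bool))) : exists q : seq Y * (Y -> bool),
    [/\ {subset p.2.1 <= q.1}, {in p.2.1, p.2.2 =1 q.2}
      & forall T, {in q.1, q.2 =1 T} -> ~ Q p.1 T].
  case: p => n [G S] /=.
  have [T [ST nT]] : exists T, {in G, S =1 T} /\ ~ Q n T.
    apply: contrapT => none; apply: nQ; exists n, S, G => T ST.
    by apply: contrapT => nT; apply: none; exists T.
  have [G' TG'] := Qclosed n T nT.
  exists (G ++ G', T); split=> //= [y yG|T' TT']; first by rewrite mem_cat yG.
  by apply: TG' => y yG'; apply: TT'; rewrite mem_cat yG' orbT.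
have [f fP] := choice shrink.
pose fix cyl (n : nat) : seq Y * (Y -> bool) :=
  if n is m.+1 then f (m, cyl m) else ([::], xpred0).
have cyl_le n m : (n <= m)%N ->
    {subset (cyl n).1 <= (cyl m).1} /\ {in (cyl n).1, (cyl n).2 =1 (cyl m).2}.
  elim: m => [|m IH]; first by rewrite leqn0 => /eqP ->.
  rewrite leq_eqVlt => /orP[/eqP ->|]; first by split=> y.
  rewrite ltnS => /IH [sub agree].
  have [sub1 agree1 _] := fP (m, cyl m); split=> y yn; first exact/sub1/sub.
  by rewrite agree //; apply/agree1/sub.
pose Slim : Y -> bool := fun y =>
  `[< exists n, y \in (cyl n).1 /\ (cyl n).2 y >].
have Slim_agree n : {in (cyl n).1, (cyl n).2 =1 Slim}.
  move=> y yn; apply/idP/asboolP => [Sy|[m [ym Sy]]]; first by exists n.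
  have [nm|/ltnW mn] := leqP n m.
    by rewrite (cyl_le _ _ nm).2.
  by rewrite -(cyl_le _ _ mn).2.
have [n Qn] := Qcover Slim.
by have [_ _ /(_ Slim (Slim_agree n.+1))] := fP (n, cyl n).
Qed.

Lemma near_all_subsets (I : Type) (F : set_system I) {FF : Filter F}
    (G : seq Y) (P : (Y -> bool) -> set I) :
  (forall S, \forall t \near F, P S t) ->
  \forall t \near F, forall S, {subset S <= G} -> P S t.
Proof.
move=> near_P.
have near_masks := @filter_forall _ {: (size G).-tuple bool}
  (fun m t => P (fun y => y \in mask m G) t) F FF (fun m => near_P _).
apply: filterS near_masks => t masks S SG.
have -> : S = (fun y => y \in mask (map S G) G).
  by apply/funext => y; rewrite -filter_mask mem_filter andb_idr // => /SG.
have sizeSG : size (map S G) == size G by rewrite size_map.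
exact: masks (Tuple sizeSG).
Qed.

End CantorSpaceOfSubsets.

Lemma large_signed_sum (R : realType) (T Y : eqType) (Z : seq T)
    (w : Y -> T -> R[i]) (G : seq Y) : uniq G ->
  exists sg : pred Y, \sum_(y <- G) l2sq Z (w y) <=
    l2sq Z (fun x => \sum_(y <- G) (-1) ^+ sg y * w y x).
Proof.
elim: G => [_|y G IH /= /andP[yG uG]].
  by exists pred0; rewrite big_nil; apply: l2sq_ge0.
have [sg sgP] := IH uG.
set f := (fun x : T => _) in sgP.
pose sgn (b : bool) z := if z == y then b else sg z.
have sgnE b x :
    \sum_(z <- y :: G) (-1) ^+ sgn b z * w z x = (-1) ^+ b * w y x + f x.
  rewrite big_cons /sgn eqxx; congr (_ + _); apply: eq_big_seq => z zG.
  by case: eqP => // zy; rewrite -zy zG in yG.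
have := l2sq_parallelogram Z (w y) f; rewrite big_cons => par.
have [plus|minus] := leP (l2sq Z (w y) + l2sq Z f)
    (l2sq Z (fun x => w y x + f x)).
  exists (sgn false); rewrite [leRHS](eq_l2sq (fun x _ => sgnE _ x)).
  rewrite [leRHS](eq_l2sq (g := fun x => w y x + f x)); first lra.
  by move=> x _; rewrite expr0 mul1r.
exists (sgn true); rewrite [leRHS](eq_l2sq (fun x _ => sgnE _ x)).
rewrite [leRHS](eq_l2sq (g := fun x => - w y x + f x)); first lra.
by move=> x _; rewrite expr1 mulN1r.
Qed.

Section SpatialIsomorphism.
Variables (R : realType) (X Y : eqType).
Variables (dX : X -> X -> R) (dY : Y -> Y -> R).
Variables (phi : mat R X -> mat R Y) (psi : mat R Y -> mat R X).
Variable V : Y -> X -> R[i].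
Hypotheses (mX : is_metric dX) (mY : is_metric dY) (uX : ulf dX) (uY : ulf dY).
Hypothesis iso : spatial_iso dX dY phi psi V.
Implicit Types (S T : Y -> bool) (s t F : seq X) (G : seq Y) (xi : X -> R[i]).

Local Notation q S := (psi (mproj S)).

Let hpsi : star_hom dY dX psi. Proof. by case: iso => -[]. Qed.

Let psiV : implements psi V. Proof. by case: iso. Qed.

Let row_unit := spatial_iso_row_unit mX mY uX uY iso.

Lemma spatial_iso_cols_orthonormal x z :
  net_sum (fun y => V y x * conjc (V y z)) (x == z)%:R.
Proof.
have := spatial_iso_rows_orthonormal mY mX uY uX (spatial_iso_sym iso) x z.
by congr net_sum; apply/funext => y; rewrite conjcK.
Qed.

Lemma spatial_iso_col_unit x :
  l2sq G (V^~ x) @[G --> exhausting Y] --> (1 : R).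
Proof.
have := spatial_iso_row_unit mY mX uY uX (spatial_iso_sym iso) x.
by under eq_fun do rewrite l2sq_conj.
Qed.

Lemma psi_mprojU S T : (forall y, ~~ (S y && T y)) ->
  q (fun y => S y || T y) = madd (q S) (q T).
Proof.
by move=> disj; rewrite mprojU // (star_homD hpsi) //; apply: uroe_mproj.
Qed.

Lemma psi_mproj_split S T :
  q S = madd (q (fun y => S y && T y)) (q (fun y => S y && ~~ T y)).
Proof.
rewrite -psi_mprojU => [|y]; last by case: (S y) (T y) => [] [].
by congr (psi (mproj _)); apply/funext => y; case: (S y) (T y) => [] [].
Qed.

Lemma psi_mproj_set0 a b : q xpred0 a b = 0.
Proof.
have := congr1 (fun m => m a b) (@psi_mprojU xpred0 xpred0 (fun=> isT)).
by rewrite /madd => /eqP; rewrite -subr_eq0 opprD addNKr oppr_eq0 => /eqP.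
Qed.

Lemma psi_mproj_seq G a b : uniq G ->
  q (fun y => y \in G) a b = \sum_(y <- G) V y a * conjc (V y b).
Proof.
elim: G => [_|y G IH /= /andP[yG uG]]; first by rewrite big_nil psi_mproj_set0.
rewrite big_cons -IH // -psiV munit_diag -[RHS]/(madd _ _ a b) -psi_mprojU.
  by congr (psi (mproj _) a b); apply/funext => z; rewrite inE.
by move=> z; apply: contraNN yG => /andP[/eqP ->].
Qed.

Lemma psi_mproj_projection S : projection (q S).
Proof.
apply: (star_hom_projection hpsi); first exact: uroe_mproj.
exact: projection_mproj.
Qed.

Lemma psi_mproj_opsq S : opsq_le (q S) 1.
Proof. exact: projection_contraction (psi_mproj_projection S). Qed.

Lemma psi_mproj_diag_le S G x : uniq G -> {in G, forall y, ~~ S y} ->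
  complex.Re (q S x x) + l2sq G (V^~ x) <= 1.
Proof.
move=> uG SG; pose T y := S y || (y \in G).
have TE : q T = madd (q S) (q (fun y => y \in G)).
  by apply: psi_mprojU => y; apply/negP => /andP[+ /SG/negP]; exact.
have -> : complex.Re (q S x x) + l2sq G (V^~ x) = complex.Re (q T x x).
  rewrite TE /madd raddfD /= psi_mproj_seq // raddf_sum; congr (_ + _).
  by apply: eq_bigr => y _; rewrite /= mulc_conj.
have := opsq_entry x x (psi_mproj_opsq T).
have := projection_diag_ge0 x (psi_mproj_projection T).
rewrite (projection_diag_real x (psi_mproj_projection T)) sqmod_real /=; nra.
Qed.

Lemma psi_mproj_cvg S x z : cvgc (trace_nbhs S) (fun T => q T x z) (q S x z).
Proof.
apply/cvgc_normP => e e0; have e4 : 0 < e ^+ 2 / 4.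
  by rewrite divr_gt0 // exprn_gt0.
have col_gt : 1 - e ^+ 2 / 4 < 1 by lra.
have [G [uG G_gt]] := filter_ex (filterI (exhausting_uniq Y)
  (cvgr_gt _ (spatial_iso_col_unit z) _ col_gt)).
exists G => T ST.
have tail_le U : {in G, forall y, ~~ U y} -> sqmod (q U x z) <= e ^+ 2 / 4.
  move=> UG; have := projection_entry_le x z (psi_mproj_projection U).
  by have := psi_mproj_diag_le z uG UG; lra.
have TS_le : sqmod (q (fun y => T y && ~~ S y) x z) <= e ^+ 2 / 4.
  by apply: tail_le => y /ST ->; case: (T y).
have ST_le : sqmod (q (fun y => S y && ~~ T y) x z) <= e ^+ 2 / 4.
  by apply: tail_le => y /ST ->; case: (T y).
have -> : q T x z - q S x z =
    q (fun y => T y && ~~ S y) x z - q (fun y => S y && ~~ T y) x z.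
  rewrite (psi_mproj_split T S) (psi_mproj_split S T) /madd.
  have -> : (fun y => T y && S y) = (fun y => S y && T y).
    by apply/funext => y; rewrite andbC.
  ring.
rewrite normc_le_sqmod ?(ltW e0) //; apply: le_trans (sqmodD_le _ _) _.
rewrite sqmodN; lra.
Qed.

Lemma quasi_local_psi_mproj_closed K r S : ~ quasi_local dX (q S) K r ->
  \forall T \near trace_nbhs S, ~ quasi_local dX (q T) K r.
Proof.
move=> nql; have [s [t [xi [us ut st bad]]]] : exists s t xi,
    [/\ uniq s, uniq t, far_apart dX r s t
      & K * l2sq t xi < l2sq s (mapply t (q S) xi)].
  apply: contrapT => none; apply: nql => s t xi us ut st.
  by rewrite leNgt; apply/negP => bad; apply: none; exists s, t, xi.
have norm_cvg : l2sq s (mapply t (q T) xi) @[T --> trace_nbhs S] -->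
    l2sq s (mapply t (q S) xi).
  apply: cvg_l2sq => x; apply: cvgc_sum => z; apply: cvgcMr.
  exact: psi_mproj_cvg.
apply: filterS (cvgr_gt _ norm_cvg _ bad) => T; rewrite ltNge => /negP badT ql.
by apply: badT; apply: ql.
Qed.

(* Baire yields a bound uniform over the subsets with a prescribed trace on a
   finite [G]; an arbitrary [S] differs from one of these by subsets of [G]. *)
Lemma psi_mproj_uniform_quasi_local K : 0 < K ->
  exists r, forall S, quasi_local dX (q S) K r.
Proof.
move=> K0; have K16 : 0 < K / 16 by lra.
have near_ql S k : 0 < k -> \forall r \near +oo, quasi_local dX (q S) k r.
  move=> k0; apply: uroe_quasi_local (star_hom_uroe hpsi _) k0.
  exact: uroe_mproj.
have cover S : exists n : nat, quasi_local dX (q S) (K / 16) n%:R.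
  exact: (filter_ex (F := \oo) (cvgr_idn (near_ql S _ K16))).
have [n [S0 [G S0n]]] :=
  subsets_baire (fun n => @quasi_local_psi_mproj_closed _ n%:R) cover.
have K4 : 0 < K / 4 by lra.
have near_G : \forall r \near +oo, forall S, {subset S <= G} ->
    quasi_local dX (q S) (K / 4) r.
  by apply: near_all_subsets => S; apply: near_ql.
have [r [rG rn]] := filter_ex (filterI near_G (nbhs_pinfty_ge (num_real n%:R))).
exists r => S; pose T y := if y \in G then S0 y else S y.
have qT U : {in G, S0 =1 U} -> quasi_local dX (q U) (K / 16) r.
  by move=> /S0n; apply: quasi_local_le.
have -> : q S = madd (q (fun y => S y && (y \in G)))
    (msub (q T) (q (fun y => S0 y && (y \in G)))).
  rewrite (psi_mproj_split S (mem G)) (psi_mproj_split T (mem G)).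
  have -> : (fun y => T y && (y \in G)) = (fun y => S0 y && (y \in G)).
    by apply/funext => y; rewrite /T; case: ifP; rewrite ?andbF.
  have -> : (fun y => T y && (y \notin G)) = (fun y => S y && (y \notin G)).
    by apply/funext => y; rewrite /T; case: ifP; rewrite ?andbF.
  by apply/funext => x; apply/funext => z; rewrite /madd /msub; ring.
have qSG : quasi_local dX (q (fun y => S y && (y \in G))) (K / 4) r.
  by apply: rG => y /andP[].
apply: quasi_local_le (lexx r)
  (quasi_localD qSG (quasi_localB (qT T _) (qT _ _))).
- by lra.
- by move=> y yG; rewrite /T yG.
- by move=> y yG; rewrite yG andbT.
Qed.

Lemma mapply_psi_mproj_seq G t xi x : uniq G ->
  mapply t (q (fun y => y \in G)) xi x =
  \sum_(y <- G) inner t (V y) xi * V y x.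
Proof.
move=> uG; rewrite /mapply.
under eq_bigr do rewrite psi_mproj_seq // mulr_suml.
rewrite exchange_big /=; apply: eq_bigr => y _; rewrite mulr_suml.
by apply: eq_bigr => z _; ring.
Qed.

Lemma signed_expansion_quasi_local K : 0 < K ->
  exists r, forall G (sg : pred Y) s t xi,
  uniq G -> uniq s -> uniq t -> far_apart dX r s t ->
  l2sq s (fun x => \sum_(y <- G) (-1) ^+ sg y * (inner t (V y) xi * V y x))
    <= K * l2sq t xi.
Proof.
move=> K0; have K4 : 0 < K / 4 by lra.
have [r ql] := psi_mproj_uniform_quasi_local K4.
exists r => G sg s t xi uG us ut st.
pose Gplus := [seq y <- G | ~~ sg y]; pose Gminus := [seq y <- G | sg y].
have := quasi_localB (ql (fun y => y \in Gplus)) (ql (fun y => y \in Gminus)).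
move=> /(_ s t xi us ut st).
have -> : 2 * (K / 4) + 2 * (K / 4) = K by lra.
apply: le_trans; rewrite (eq_l2sq (fun x _ => mapplyB _ _ _ _ x)).
rewrite le_eqVlt; apply/orP; left; apply/eqP; apply: eq_l2sq => x _.
rewrite !mapply_psi_mproj_seq ?filter_uniq // !big_filter [LHS](bigID sg) addrC.
rewrite -sumrN; congr (_ + _); apply: eq_bigr => y.
  by move=> /= ->; rewrite mulN1r.
by move=> /= /negbTE ->; rewrite mul1r.
Qed.

(* Choosing signs by the parallelogram law turns the bounds above into one
   without cancellations; this replaces property A. *)
Lemma far_row_mass_le K : 0 < K -> exists r, forall G s t xi,
  uniq G -> uniq s -> uniq t -> far_apart dX r s t ->
  \sum_(y <- G) sqmod (inner t (V y) xi) * l2sq s (V y) <= K * l2sq t xi.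
Proof.
move=> /signed_expansion_quasi_local[r ql]; exists r => G s t xi uG us ut st.
have [sg sgP] :=
  large_signed_sum s (fun y x => inner t (V y) xi * V y x) uG.
apply: le_trans (ql G sg s t xi uG us ut st); apply: le_trans sgP.
by apply: ler_sum => y _; rewrite l2sqZ.
Qed.

Lemma outside_row_mass_le K : 0 < K -> \forall r \near +oo, forall G B t xi,
  uniq G -> uniq B -> uniq t ->
  (forall x z, x \notin B -> z \in t -> r < dX x z) ->
  \sum_(y <- G) sqmod (inner t (V y) xi) * (1 - l2sq B (V y)) <= K * l2sq t xi.
Proof.
move=> /far_row_mass_le[r0 far_mass]; near=> r => G B t xi uG uB ut farB.
have sum_cvg : \sum_(y <- G) sqmod (inner t (V y) xi) *
      l2sq [seq x <- F | x \notin B] (V y) @[F --> exhausting X] -->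
    \sum_(y <- G) sqmod (inner t (V y) xi) * (1 - l2sq B (V y)).
  apply: cvg_big => [|y _]; first exact: add_continuous.
  apply: cvgM; first exact: cvg_cst.
  have : l2sq F (V y) - l2sq B (V y) @[F --> exhausting X] -->
      1 - l2sq B (V y).
    by apply: cvgB (cvg_cst _); exact: row_unit.
  apply: cvg_trans; apply: near_eq_cvg.
  have := exhausting_subset B; apply: filterS2 (exhausting_uniq X) => F uF BF.
  rewrite /l2sq [X in X - _](bigID (mem B)) /= big_mem_subset // big_filter.
  by ring.
apply: (cvgr_to_le sum_cvg); apply: filterS (exhausting_uniq X) => F uF.
apply: far_mass => //; first exact: filter_uniq.
move=> x z; rewrite mem_filter => /andP[xB _] zt.
apply: le_lt_trans (farB x z xB zt).
by near: r; apply: nbhs_pinfty_ge; rewrite num_real.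
Unshelve. all: by end_near.
Qed.

Lemma parseval t xi : uniq t ->
  \sum_(y <- G) sqmod (inner t (V y) xi) @[G --> exhausting Y] --> l2sq t xi.
Proof.
move=> ut.
have expand G : (\sum_(y <- G) sqmod (inner t (V y) xi))%:C =
    \sum_(x <- t) \sum_(z <- t)
      conjc (xi x) * xi z * \sum_(y <- G) V y x * conjc (V y z).
  rewrite rmorph_sum /=.
  under [RHS]eq_bigr do under eq_bigr do rewrite mulr_sumr.
  under [RHS]eq_bigr do rewrite exchange_big.
  rewrite [RHS]exchange_big /=; apply: eq_bigr => y _.
  rewrite -mulc_conj inner_conj mulrC mulr_suml; apply: eq_bigr => x _.
  by rewrite mulr_sumr; apply: eq_bigr => z _; ring.
have limit : (l2sq t xi)%:C = \sum_(x <- t) \sum_(z <- t)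
    conjc (xi x) * xi z * (x == z)%:R.
  rewrite -inner_self /inner; apply: eq_big_seq => x xt.
  rewrite (bigD1_seq x) //= eqxx mulr1 big1 ?addr0 // => z zx.
  by rewrite eq_sym (negbTE zx) mulr0.
have [] : cvgc (exhausting Y)
    (fun G => (\sum_(y <- G) sqmod (inner t (V y) xi))%:C) (l2sq t xi)%:C.
  rewrite limit; under eq_fun do rewrite expand.
  apply: cvgc_sum => x; apply: cvgc_sum => z; apply: cvgcMl.
  exact: spatial_iso_cols_orthonormal.
by [].
Qed.

(* [munit y y'] is the corner of the single band matrix [mband dY r] at [y, y']
   as soon as [dY y y' <= r], so its image is quasi-local uniformly in such [y]
   and [y']. *)
Lemma large_entries_dist_le (r c : R) : 0 < c -> exists s : R, forall y y' a b,
  dY y y' <= r -> c <= sqmod (V y a) -> c <= sqmod (V y' b) -> dX a b <= s.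
Proof.
move=> c0; have uband := uroe_mband mY uY r.
have uW := star_hom_uroe hpsi uband; set W := psi _ in uW.
have [M M0 WM] := uroe_opsq uW.
pose K := c ^+ 2 / (2 * (6 * M + 4)).
have c2 : 0 < c ^+ 2 by rewrite exprn_gt0.
have K0 : 0 < K by rewrite divr_gt0 //; lra.
have KE : K * (6 * M + 4) = c ^+ 2 / 2 by rewrite /K; field; lra.
have [r0 ql] := psi_mproj_uniform_quasi_local K0.
have [r1 Wql] := filter_ex (uroe_quasi_local uW K0).
exists (r0 + r1 + r0) => y y' a b dyy ya yb; rewrite leNgt; apply/negP => dab.
have ue u w := uroe_munit mY uY u w.
have [row rowE cornerE] := mmul_munit_corner y y y' y' (mband dY r).
have urow : uroe dY row by apply: uroe_mul rowE.
have rowM := star_homM hpsi (ue _ _) uband urow rowE.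
have cornerM := star_homM hpsi urow (ue _ _) (uroe_scale _ (ue _ _)) cornerE.
rewrite -/W !munit_diag in rowM cornerM.
have row_opsq := opsq_leM ler01 (psi_mproj_opsq _) WM rowM.
have row_ql := quasi_localM mX ler01 (ltW K0) (psi_mproj_opsq _) WM (ql _) Wql
  rowM.
rewrite mul1r in row_opsq.
have KM0 : 0 <= 2 * (K * M) + 2 * (1 * K) by nra.
have corner_ql := quasi_localM mX M0 KM0 row_opsq (psi_mproj_opsq _) row_ql
  (ql _) cornerM.
have := quasi_local_entry corner_ql dab.
rewrite (star_homZ hpsi) // /mscale /mband dyy [true%:R * _]mul1r psiV.
rewrite sqmodM sqmod_conj.
have : c ^+ 2 <= sqmod (V y a) * sqmod (V y' b).
  by rewrite expr2 ler_pM // ltW.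
by move: (sqmod _ * sqmod _) => w; lra.
Qed.

Let inner_delta x y : sqmod (inner [:: x] (V y) (fun=> 1)) = sqmod (V y x).
Proof. by rewrite /inner big_seq1 mulr1 sqmod_conj. Qed.

Lemma exists_large_entry :
  exists2 c, 0 < c & forall x, exists y, c <= sqmod (V y x).
Proof.
have half_gt0 : 0 < 1 / 2 :> R by lra.
have [r [mass_r r0]] := filter_ex (filterI (outside_row_mass_le half_gt0)
  (nbhs_pinfty_gt (num_real 0))).
have [N ballN] := ulf_ball uX r0.
have N1 : 0 < N%:R + 1 :> R by rewrite ltr_wpDl.
exists (1 / (4 * (N%:R + 1))) => [|x]; first by rewrite divr_gt0 ?mulr_gt0.
set c := 1 / _; apply: contrapT => small.
have c0 : 0 <= c by rewrite divr_ge0 ?mulr_ge0 ?(ltW N1).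
have cN : c * N%:R <= 1 / 4.
  have : c * (N%:R + 1) = 1 / 4 by rewrite /c; field; lra.
  lra.
have entry_le y : sqmod (V y x) <= c.
  by rewrite leNgt; apply/negP => /ltW large; apply: small; exists y.
have [B [uB sizeB ballB]] := ballN x.
suff : (1 : R) <= 3 / 4 by lra.
apply: (cvgr_to_le (spatial_iso_col_unit x)).
apply: filterS (exhausting_uniq Y) => G uG.
have far_le := mass_r G B [:: x] (fun=> 1) uG uB isT.
have {}far_le : \sum_(y <- G) sqmod (V y x) * (1 - l2sq B (V y)) <= 1 / 2.
  under eq_bigr do rewrite -inner_delta.
  rewrite [leRHS](_ : _ = 1 / 2 * l2sq [:: x] (fun=> 1)); last first.
    by rewrite l2sq1 sqmod1 mulr1.
  apply: far_le => a z; rewrite ballB -ltNge inE => + /eqP ->.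
  by rewrite (is_metric_sym mX).
have near_le : \sum_(y <- G) sqmod (V y x) * l2sq B (V y) <= 1 / 4.
  apply: le_trans cN.
  apply: (@le_trans _ _ (\sum_(y <- G) c * l2sq B (V y))).
    by apply: ler_sum => y _; rewrite ler_wpM2r ?l2sq_ge0.
  rewrite -mulr_sumr ler_wpM2l // exchange_big.
  apply: (@le_trans _ _ (\sum_(a <- B) 1)).
    by apply: ler_sum => a _; apply: l2sq_le_lim uG (spatial_iso_col_unit a).
  by rewrite big_const_seq count_predT iter_addr_0 ler_nat.
have -> : l2sq G (V^~ x) = \sum_(y <- G) sqmod (V y x) * (1 - l2sq B (V y)) +
    \sum_(y <- G) sqmod (V y x) * l2sq B (V y).
  by rewrite -big_split; apply: eq_bigr => y _ /=; ring.
lra.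
Qed.

Lemma large_entry_row_mass c e : 0 < c -> 0 < e -> \forall r \near +oo,
  forall y x B, c <= sqmod (V y x) -> uniq B ->
  (forall a, a \notin B -> r < dX a x) -> 1 - e <= l2sq B (V y).
Proof.
move=> c0 e0; apply: filterS (outside_row_mass_le (mulr_gt0 c0 e0)) => r mass_r.
move=> y x B cy uB farB.
have := mass_r [:: y] B [:: x] (fun=> 1) isT uB isT.
rewrite big_seq1 inner_delta l2sq1 sqmod1 mulr1 => far_le.
have {far_le} : sqmod (V y x) * (1 - l2sq B (V y)) <= c * e.
  by apply: far_le => a z aB; rewrite inE => /eqP ->; apply: farB.
have [|neg] := leP (1 - l2sq B (V y)) 0; first lra.
move/(le_trans (ler_wpM2r (ltW neg) cy)); rewrite ler_pM2l //; lra.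
Qed.

Lemma disjoint_row_mass_le B B' y : uniq B -> uniq B' ->
  {in B, forall a, a \notin B'} -> l2sq B (V y) + l2sq B' (V y) <= 1.
Proof.
move=> uB uB' disj; rewrite -big_cat; apply: l2sq_le_lim (row_unit y).
rewrite cat_uniq uB uB' andbT; apply/hasPn => a aB'.
by apply: contraL aB' => /disj.
Qed.

(* If [A] had more points than there are [y] with [g y] close to [A], some
   nonzero [xi] supported on [A] would be orthogonal to all the corresponding
   rows of [V]; the other rows have little mass near [A], against Parseval. *)
Lemma rows_hall_condition (g : Y -> X) c : 0 < c ->
  (forall y, c <= sqmod (V y (g y))) -> exists M,
  forall (A : seq X) (G : seq Y), uniq A ->
  (forall y x, x \in A -> dX x (g y) <= M -> y \in G) -> (size A <= size G)%N.
Proof.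
move=> c0 cg; have half_gt0 : 0 < 1 / 2 :> R by lra.
have quarter_gt0 : 0 < 1 / 4 :> R by lra.
have [r [mass_r [large_r r0]]] := filter_ex (filterI
  (outside_row_mass_le quarter_gt0) (filterI (large_entry_row_mass c0 half_gt0)
  (nbhs_pinfty_gt (num_real 0)))).
exists (r + r) => A G uA AG; rewrite leqNgt; apply/negP => sizeGA.
have [xi [x0 x0A xi_x0] xi_perp] :=
  underdetermined_system (fun y x => conjc (V y x)) uA sizeGA.
have xi_gt0 : 0 < l2sq A xi.
  rewrite lt_neqAle l2sq_ge0 andbT eq_sym; apply: contraNneq xi_x0.
  by move=> /l2sq_eq0 ->.
have [B uB nearA] := ulf_neighborhood uX A r0.
have half_mass y : y \notin G -> l2sq B (V y) <= 1 / 2.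
  move=> yG; have [B' uB' near_gy] := ulf_neighborhood uX [:: g y] r0.
  have : 1 - 1 / 2 <= l2sq B' (V y).
    apply: large_r (cg y) uB' _ => a.
    by rewrite near_gy has_seq1 -ltNge (is_metric_sym mX).
  suff : l2sq B (V y) + l2sq B' (V y) <= 1 by lra.
  apply: disjoint_row_mass_le => // a; rewrite nearA => /hasP[x xA dxa].
  rewrite near_gy has_seq1; apply: contra yG => dga.
  apply: (AG y x xA); apply: le_trans (is_metric_triangle mX x a (g y)) _.
  by rewrite lerD // (is_metric_sym mX).
suff : l2sq A xi <= 1 / 2 * l2sq A xi by lra.
apply: (cvgr_to_le (parseval (xi := xi) uA)).
apply: filterS (exhausting_uniq Y) => G' uG'.
have := mass_r G' B A xi uG' uB uA.
suff mass_le : \sum_(y <- G') sqmod (inner A (V y) xi) * (1 / 2) <=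
    \sum_(y <- G') sqmod (inner A (V y) xi) * (1 - l2sq B (V y)).
  rewrite -mulr_suml in mass_le; move=> outside_le.
  suff : \sum_(y <- G') sqmod (inner A (V y) xi) * (1 - l2sq B (V y)) <=
    1 / 4 * l2sq A xi by lra.
  apply: outside_le => x z xB zA; rewrite ltNge; apply: contra xB => dxz.
  by rewrite nearA; apply/hasP; exists z; rewrite // (is_metric_sym mX).
apply: ler_sum => y _; have [yG|yG] := boolP (y \in G).
  by rewrite /inner xi_perp // sqmod0 !mul0r.
by rewrite ler_wpM2l ?sqmod_ge0 //; have := half_mass y yG; lra.
Qed.

Lemma large_entry_maps_coarse_close (c : R) (f : X -> Y) (g : Y -> X) : 0 < c ->
  (forall x, c <= sqmod (V (f x) x)) -> (forall y, c <= sqmod (V y (g y))) ->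
  coarse dY dX g /\ close dX (g \o f) id.
Proof.
move=> c0 fV gV; have bound r := large_entries_dist_le r c0.
split=> [r _|].
  have [s sP] := bound r; exists (Num.max s 1).
  split=> [|y y' yy']; first by rewrite lt_max ltr01 orbT.
  by rewrite le_max (sP y y').
have [s sP] := bound 0; exists s => x.
by apply: (sP (f x) (f x)); rewrite ?(is_metric_refl mY) /=.
Qed.

End SpatialIsomorphism.

Lemma exists_large_entry_maps (R : realType) (X Y : eqType)
    (dX : X -> X -> R) (dY : Y -> Y -> R) phi psi V :
  is_metric dX -> is_metric dY -> ulf dX -> ulf dY ->
  spatial_iso dX dY phi psi V ->
  exists c (f : X -> Y) (g : Y -> X),
  [/\ 0 < c, forall x, c <= sqmod (V (f x) x)
    & forall y, c <= sqmod (V y (g y))].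
Proof.
move=> mX mY uX uY iso.
have [c c0 /choice[f fV]] := exists_large_entry mX mY uX uY iso.
have [c' c'0 /choice[g gV]] :=
  exists_large_entry mY mX uY uX (spatial_iso_sym iso).
exists (Num.min c c'), f, g; split=> [|x|y]; first by rewrite lt_min c0.
  by rewrite ge_min fV.
by rewrite ge_min -sqmod_conj gV orbT.
Qed.

Theorem theorem3p1 (R : realType) (X Y : choiceType)
  (dX : X -> X -> R) (dY : Y -> Y -> R) :
  is_metric dX -> is_metric dY -> ulf dX -> ulf dY ->
  uroe_isomorphic dX dY -> bij_coarse_equiv dX dY.
Proof.
move=> mX mY uX uY.
move=> /(uroe_isomorphic_spatial mX mY uX uY)[phi [psi [V iso]]].
have iso' := spatial_iso_sym iso.
have [c [f [g [c0 fV gV]]]] := exists_large_entry_maps mX mY uX uY iso.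
have fV' x : c <= sqmod (conjc (V (f x) x)) by rewrite sqmod_conj.
have gV' y : c <= sqmod (conjc (V y (g y))) by rewrite sqmod_conj.
have [gc gf] := large_entry_maps_coarse_close mX mY uX uY iso c0 fV gV.
have [fc fg] := large_entry_maps_coarse_close mY mX uY uX iso' c0 gV' fV'.
have [h h_inj fh] := hall_injection mY uY fc fg
  (rows_hall_condition mX mY uX uY iso c0 gV).
have [k k_inj gk] := hall_injection mX uX gc gf
  (rows_hall_condition mY mX uY uX iso' c0 fV').
exact: bij_coarse_equiv_of_injections fc gc fg gf h_inj fh k_inj gk.
Qed.
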